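(* Let $M=B_f\times{}_hF$ be a doubly warped product manifold with metric $g$ and let $P\in\mathfrak{X}(F)$. Let $\tilde r$, ${}^B\tilde r$, ${}^F\tilde r$ be the scalar curvatures of the semi-symmetric metric connections $\tilde\nabla$, ${}^B\tilde\nabla$, ${}^F\tilde\nabla$ associated with $P$. Then $$\tilde r=\frac{{}^Br}{f^2}+\frac{{}^F\tilde r}{h^2}-n_1(n_1-1)\frac{\|\mathrm{grad}\,f\|^2}{f^2}-n_2(n_2-1)\frac{\|\mathrm{grad}\,h\|^2}{h^2}-2n_1(n-1)\frac{Pf}{f}-2n_1\frac{{}^F\Delta f}{f}-2n_2\frac{{}^B\Delta h}{h}-2n_1\,\mathrm{div}P-n_1(n+n_2-3)\pi(P).$$
   Context: $(B,g_B)$ and $(F,g_F)$ are Riemannian manifolds of dimensions $n_1$ and $n_2$, $n=n_1+n_2$, and $h:B\to(0,\infty)$, $f:F\to(0,\infty)$ are smooth. With $\rho:B\times F\to B$, $\sigma:B\times F\to F$ the projections, the doubly warped product $M=B_f\times{}_hF$ is $B\times F$ with the metric $g=(f\circ\sigma)^2\rho^*g_B+(h\circ\rho)^2\sigma^*g_F$. The functions $f,h$ and vector fields on $B$ and $F$ are identified with their lifts to $M$. $\nabla,{}^B\nabla,{}^F\nabla$ are the Levi-Civita connections of $M,B,F$ (${}^B\nabla$, ${}^F\nabla$ applied leafwise on $M$); ${}^Br$ is the scalar curvature of $(B,g_B)$. Gradients and norms are taken with respect to $g$. ${}^B\Delta h$ is the Laplacian of $h$ on $B$ and ${}^F\Delta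 f$ the Laplacian of $f$ on $F$, i.e. the traces with respect to $g$ (over the tangent directions of $B$, resp. $F$) of the Hessians $XYh-({}^B\nabla_XY)h$, resp. $VWf-({}^F\nabla_VW)f$. For $P\in\mathfrak{X}(F)$, $\mathrm{div}P=\sum_j g({}^F\nabla_{u_j}P,u_j)$ over a $g$-orthonormal frame $(u_j)$ tangent to $F$. Put $\pi(A)=g(A,P)$. The semi-symmetric metric connection on $M$ associated with $P$ is $\tilde\nabla_AC=\nabla_AC+\pi(C)A-g(A,C)P$. For $P\in\mathfrak{X}(F)$: ${}^F\tilde\nabla_VW={}^F\nabla_VW+\pi(W)V-g(V,W)P$ for $V,W\in\mathfrak{X}(F)$ (leafwise on $\{p\}\times F$ with the metric induced by $g$) and ${}^B\tilde\nabla={}^B\nabla$. Conventions: $\tilde R(A,C)D=\tilde\nabla_A\tilde\nabla_CD-\tilde\nabla_C\tilde\nabla_AD-\tilde\nabla_{[A,C]}D$, $\tilde S(C,D)=\mathrm{trace}(A\mapsto\tilde R(A,C)D)$, and likewise ${}^F\tilde S$ for ${}^F\tilde\nabla$; $\tilde r$ is the trace of $\tilde S$ with respect to $g$, and ${}^F\tilde r$ is the trace of ${}^F\tilde S$ with respect to $g_F$. *)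

(* Defs.v *)
From HB Require Import structures.
From mathcomp Require Import all_boot all_order all_algebra.
From mathcomp Require Import boolp classical_sets functions cardinality.
From mathcomp Require Import reals topology normedtype derive.

Set Implicit Arguments.
Unset Strict Implicit.
Unset Printing Implicit Defensive.

Import Order.TTheory GRing.Theory Num.Theory.
Import numFieldNormedType.Exports.

Local Open Scope classical_set_scope.
Local Open Scope ring_scope.

(* On an open D in finite dimension, [smooth D] is C^oo: all the iterated
   directional derivatives exist and are differentiable, hence continuous. *)
Section Smoothness.
Context {R : realType} {n : nat}.
Implicit Types (D : set 'rV[R]_n) (u : 'rV[R]_n -> R).

Fixpoint Ck k D u : Prop :=
  if k is k'.+1 then
    (forall x, D x -> differentiable u x) /\
    (forall v, Ck k' D (fun x => 'D_v u x))
  else forall x, D x -> {for x, continuous u}.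

Definition smooth D u := forall k, Ck k D u.

Definition smooth_mx p q D (f : 'rV[R]_n -> 'M[R]_(p, q)) :=
  forall i j, smooth D (fun x => f x i j).

End Smoothness.

(* A smooth manifold of dimension n, given by an atlas. The chart with index i
   is [chart_map i : cdom i -> 'rV_n], with inverse [chart_inv i]; both are
   total functions, whose values off [cdom i] and [chart_map i @` cdom i] are
   irrelevant. *)
Record manifold (R : realType) (n : nat) := Manifold {
  carrier :> topologicalType;
  chart : Type;
  cdom : chart -> set carrier;
  chart_map : chart -> carrier -> 'rV[R]_n;
  chart_inv : chart -> 'rV[R]_n -> carrier;
  manifold_hausdorff : hausdorff_space carrier;
  manifold_second_countable : @second_countable carrier;
  cdom_cover : forall p, exists i, cdom i p;
  cdom_open : forall i, open (cdom i);
  chart_map_open : forall i, open (chart_map i @` cdom i);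
  chart_mapK : forall i p, cdom i p -> chart_inv i (chart_map i p) = p;
  chart_map_cont : forall i p, cdom i p -> {for p, continuous (chart_map i)};
  chart_inv_cont : forall i p,
    cdom i p -> {for chart_map i p, continuous (chart_inv i)};
  transition_smooth : forall i j,
    smooth_mx (chart_map i @` (cdom i `&` cdom j)) (chart_map j \o chart_inv i)
}.

Definition cimg R n (M : manifold R n) (i : chart M) : set 'rV[R]_n :=
  chart_map i @` cdom i.

Definition transition R n (M : manifold R n) (i j : chart M) :=
  chart_map j \o chart_inv i.

Definition overlap R n (M : manifold R n) (i j : chart M) : set 'rV[R]_n :=
  chart_map i @` (cdom i `&` cdom j).

Definition smooth_fun R n (M : manifold R n) (u : M -> R) :=
  forall i : chart M, smooth (cimg i) (u \o chart_inv i).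

Section Product.
Context {R : realType} {n1 n2 : nat}.

Lemma Ck_comp_linear m p (L : {linear 'rV[R]_m -> 'rV[R]_p}) k D u :
  continuous L -> Ck k D u -> Ck k (L @^-1` D) (u \o L).
Proof.
move=> Lc; elim: k u => [|k IH] u /=.
  by move=> uc x Dx; apply: continuous_comp; [exact: Lc|exact: uc].
move=> [ud uk]; split=> [x Dx|v].
  apply: differentiable_comp; last exact: ud.
  exact: linear_differentiable.
suff -> : (fun x => 'D_v (u \o L) x) = (fun y => 'D_(L v) u y) \o L.
  exact: IH.
apply/funext => x /=; rewrite /derive.
set a := (X in lim (X @ _)); set b := (X in _ = lim (X @ _)).
suff -> : a = b by [].
apply/funext => t; rewrite /a /b /=. by rewrite -(linearP L).
Qed.

Lemma Ck_sub m k (D D' : set 'rV[R]_m) u : D `<=` D' -> Ck k D' u -> Ck k D u.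
Proof.
move=> DD'; elim: k u => [|k IH] u /= ; first by move=> uc x /DD'/uc.
by move=> [ud uk]; split=> [x /DD'/ud|v] //; exact/IH.
Qed.

Variables (B : manifold R n1) (F : manifold R n2).
Implicit Types c : chart B * chart F.

Let pdom c : set (B * F) := cdom c.1 `*` cdom c.2.
Let pcoord c (z : B * F) : 'rV[R]_(n1 + n2) :=
  row_mx (chart_map c.1 z.1) (chart_map c.2 z.2).
Let pparam c (z : 'rV[R]_(n1 + n2)) : B * F :=
  (chart_inv c.1 (lsubmx z), chart_inv c.2 (rsubmx z)).

Lemma prod_hausdorff : hausdorff_space (B * F)%type.
Proof.
move=> [p1 p2] [q1 q2] pq; congr (_, _).
- have hs := @manifold_hausdorff _ _ B; apply: hs => U V pU qV.
  have pU' : nbhs (p1, p2) (U `*` [set: F]).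
    by exists (U, setT) => //=; split => //; exact: filterT.
  have qV' : nbhs (q1, q2) (V `*` [set: F]).
    by exists (V, setT) => //=; split => //; exact: filterT.
  by have [z [[zU _] [zV _]]] := pq _ _ pU' qV'; exists z.1.
- have hs := @manifold_hausdorff _ _ F; apply: hs => U V pU qV.
  have pU' : nbhs (p1, p2) ([set: B] `*` U).
    by exists (setT, U) => //=; split => //; exact: filterT.
  have qV' : nbhs (q1, q2) ([set: B] `*` V).
    by exists (setT, V) => //=; split => //; exact: filterT.
  by have [z [[_ zU] [_ zV]]] := pq _ _ pU' qV'; exists z.2.
Qed.

Lemma open_setX (S T : topologicalType) (U : set S) (V : set T) :
  open U -> open V -> open (U `*` V).
Proof.
move=> oU oV; rewrite openE => -[x y] [/= Ux Vy].
by exists (U, V) => //; split; exact: open_nbhs_nbhs.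
Qed.

Lemma prod_second_countable : @second_countable (B * F)%type.
Proof.
have [SB cSB [oSB bSB]] := @manifold_second_countable _ _ B.
have [SF cSF [oSF bSF]] := @manifold_second_countable _ _ F.
exists [set UV.1 `*` UV.2 | UV in SB `*` SF].
  exact: (sub_countable (card_image_le _ _) (countableX cSB cSF)).
split=> [_ [[U V] [/= /oSB oU /oSF oV] <-]|[x y] W [[U V] [/= xU yV] UVW]].
  exact: open_setX.
have [U' [SU' U'x] U'U] := bSB x U xU.
have [V' [SV' V'y] V'V] := bSF y V yV.
exists (U' `*` V'); last by move=> z [/U'U ? /V'V ?]; exact: UVW.
by split; [exists (U', V')|split].
Qed.

Lemma prod_cover z : exists c, pdom c z.
Proof.
have [i iz] := cdom_cover z.1; have [j jz] := cdom_cover z.2.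
by exists (i, j).
Qed.

Lemma prod_open c : open (pdom c).
Proof. by apply: open_setX; exact: cdom_open. Qed.

Lemma prod_coord_image c (U : set B) (V : set F) :
  pcoord c @` (U `*` V) =
  (lsubmx @^-1` (chart_map c.1 @` U)) `&` (rsubmx @^-1` (chart_map c.2 @` V)).
Proof.
apply/seteqP; split=> [_ [z [zU zV] <-]|z [[x Ux xz] [y Vy yz]]].
  by split; rewrite /= (row_mxKl, row_mxKr); [exists z.1|exists z.2].
by exists (x, y) => //; rewrite /pcoord /= xz yz hsubmxK.
Qed.

Lemma prod_coord_open c : open (pcoord c @` pdom c).
Proof.
rewrite prod_coord_image.
apply: openI; apply: open_comp; try exact: chart_map_open.
- by move=> ? _; exact: continuous_lsubmx.
- by move=> ? _; exact: continuous_rsubmx.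
Qed.

Lemma prod_coordK c z : pdom c z -> pparam c (pcoord c z) = z.
Proof.
by case: z => x y [/= ? ?]; rewrite /pparam row_mxKl row_mxKr !chart_mapK.
Qed.

Lemma prod_coord_cont c z : pdom c z -> {for z, continuous (pcoord c)}.
Proof.
case: z => x y [/= Dx Dy] A /nbhs_ballP[e /= e0 eA].
have /= xe := chart_map_cont Dx (nbhsx_ballx _ _ e0).
have /= ye := chart_map_cont Dy (nbhsx_ballx _ _ e0).
exists (chart_map c.1 @^-1` ball (chart_map c.1 x) e,
        chart_map c.2 @^-1` ball (chart_map c.2 y) e) => //=.
move=> -[x' y'] [/= x'e y'e].
apply: eA; split=> // i k; rewrite /pcoord /= !mxE.
by case: splitP => l _; [apply x'e|apply y'e].
Qed.

Lemma prod_param_cont c z :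
  pdom c z -> {for pcoord c z, continuous (pparam c)}.
Proof.
case: z => x y [/= Dx Dy]; set w := pcoord c (x, y).
have cB : {for w, continuous (chart_inv c.1 \o lsubmx)}.
  apply: continuous_comp; first exact: continuous_lsubmx.
  by rewrite row_mxKl; exact: chart_inv_cont.
have cF : {for w, continuous (chart_inv c.2 \o rsubmx)}.
  apply: continuous_comp; first exact: continuous_rsubmx.
  by rewrite row_mxKr; exact: chart_inv_cont.
exact: (cvg_pair cB cF).
Qed.

Lemma prod_transition_smooth c d :
  smooth_mx (pcoord c @` (pdom c `&` pdom d)) (pcoord d \o pparam c).
Proof.
rewrite /pdom -setXI prod_coord_image => i l k.
rewrite -(splitK l); case: (fintype.split l) => m.
- have -> : (fun x => (pcoord d \o pparam c) x i (unsplit (inl m))) =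
      (fun x => (transition c.1 d.1) x i m) \o lsubmx.
    by apply/funext => x; rewrite /= row_mxEl.
  apply: (@Ck_sub _ k _ (lsubmx @^-1` overlap c.1 d.1)) => [z []//|].
  apply: Ck_comp_linear; first exact: continuous_lsubmx.
  exact: transition_smooth.
- have -> : (fun x => (pcoord d \o pparam c) x i (unsplit (inr m))) =
      (fun x => (transition c.2 d.2) x i m) \o rsubmx.
    by apply/funext => x; rewrite /= row_mxEr.
  apply: (@Ck_sub _ k _ (rsubmx @^-1` overlap c.2 d.2)) => [z []//|].
  apply: Ck_comp_linear; first exact: continuous_rsubmx.
  exact: transition_smooth.
Qed.

Definition prod_manifold : manifold R (n1 + n2) :=
  Manifold prod_hausdorff prod_second_countable prod_cover prod_open
    prod_coord_open prod_coordK prod_coord_cont prod_param_cont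
    prod_transition_smooth.

End Product.

(* Tensor calculus on an open subset D of 'rV_n. Vector fields and metrics on D
   are total functions, of which only the values on D matter. A tangent vector v
   at a point is extended to the vector field [cst v] with constant components:
   the curvature, the Hessian and V |-> N V P are tensorial in the arguments
   that are so extended, hence do not depend on the extension. *)
Section Local.
Context {R : realType} {n : nat}.
Local Notation point := 'rV[R]_n.
Local Notation field := ('rV[R]_n -> 'rV[R]_n).
Local Notation metric := ('rV[R]_n -> 'M[R]_n).
Implicit Types (A C E P : field) (u : point -> R) (G : metric).
Implicit Types (D : set point) (N : field -> field -> field).

Definition inner (g : 'M[R]_n) (v w : 'rV[R]_n) : R := (v *m g *m w^T) 0 0.

Definition metric_norm (g : 'M[R]_n) (v : 'rV[R]_n) : R :=
  Num.sqrt (inner g v v).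

(* The trace of the bilinear form T with respect to g, in the basis of unit row
   vectors; [gtrace_orthonormal] is its expression in a g-orthonormal basis. *)
Definition gtrace (g : 'M[R]_n) (T : 'rV[R]_n -> 'rV[R]_n -> R) : R :=
  \sum_i \sum_j invmx g i j * T (delta_mx 0 i) (delta_mx 0 j).

Lemma gtrace_orthonormal (g T E : 'M[R]_n) : E *m g *m E^T = 1%:M ->
  gtrace g (inner T) = \sum_j inner T (row j E) (row j E).
Proof.
move=> Eg.
have [Eu] := mulmx1_unit (etrans (mulmxA _ _ _) Eg).
rewrite unitmx_mul unitmx_tr => /andP[gu _].
rewrite /gtrace; have -> : invmx g = E^T *m E.
  apply: (can_inj (mulKmx gu)); rewrite mulmxV // mulmxA.
  by apply/esym/mulmx1C; rewrite mulmxA.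
have innerE v w : inner T v w = \sum_i \sum_j v 0 i * w 0 j * T i j.
  rewrite /inner mxE exchange_big /=; apply: eq_bigr => j _.
  by rewrite !mxE mulr_suml; apply: eq_bigr => i _; rewrite mulrAC.
under [RHS]eq_bigr do rewrite innerE.
rewrite [RHS]exchange_big /=; apply: eq_bigr => i _.
rewrite [RHS]exchange_big /=; apply: eq_bigr => j _.
rewrite mxE mulr_suml; apply: eq_bigr => k _; rewrite !mxE; congr (_ * _).
by rewrite /inner trmx_delta -rowE -colE !mxE.
Qed.

Definition dirder A u : point -> R := fun x => 'D_(A x) u x.

Definition bracket A C : field := fun x => 'D_(A x) C x - 'D_(C x) A x.

Record affine_connection D N : Prop := AffineConnection {
  conn_local : forall A A' C C',
    smooth_mx D A -> smooth_mx D A' -> smooth_mx D C -> smooth_mx D C' ->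
    (forall x, D x -> A x = A' x) -> (forall x, D x -> C x = C' x) ->
    forall x, D x -> N A C x = N A' C' x;
  conn_smooth : forall A C,
    smooth_mx D A -> smooth_mx D C -> smooth_mx D (N A C);
  conn_addl : forall A A' C,
    smooth_mx D A -> smooth_mx D A' -> smooth_mx D C ->
    forall x, D x -> N (A \+ A') C x = N A C x + N A' C x;
  conn_scalel : forall u A C,
    smooth D u -> smooth_mx D A -> smooth_mx D C ->
    forall x, D x -> N (fun y => u y *: A y) C x = u x *: N A C x;
  conn_addr : forall A C C',
    smooth_mx D A -> smooth_mx D C -> smooth_mx D C' ->
    forall x, D x -> N A (C \+ C') x = N A C x + N A C' x;
  conn_leibniz : forall u A C,
    smooth D u -> smooth_mx D A -> smooth_mx D C ->
    forall x, D x ->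
      N A (fun y => u y *: C y) x = dirder A u x *: C x + u x *: N A C x
}.

Definition torsion_free D N := forall A C,
  smooth_mx D A -> smooth_mx D C ->
  forall x, D x -> N A C x - N C A x = bracket A C x.

Definition metric_compatible D G N := forall A C E,
  smooth_mx D A -> smooth_mx D C -> smooth_mx D E ->
  forall x, D x -> dirder A (fun y => inner (G y) (C y) (E y)) x =
    inner (G x) (N A C x) (E x) + inner (G x) (C x) (N A E x).

Definition levi_civita_on D G N :=
  [/\ affine_connection D N, torsion_free D N & metric_compatible D G N].

(* The semi-symmetric metric connection associated with P and N; its 1-form is
   pi(C) = G(C, P). *)
Definition semisym G N P A C : field := fun x =>
  N A C x + inner (G x) (C x) (P x) *: A x - inner (G x) (A x) (C x) *: P x.

Definition curv N A C E : field := fun x =>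
  N A (N C E) x - N C (N A E) x - N (bracket A C) E x.

Definition ricci N C E : point -> R := fun x =>
  \tr (lin1_mx (fun v => curv N (cst v) C E x)).

Definition scal G N : point -> R := fun x =>
  gtrace (G x) (fun v w => ricci N (cst v) (cst w) x).

Definition grad G u : field := fun x =>
  (\row_j 'D_(delta_mx 0 j) u x) *m invmx (G x).

Lemma inner_grad G u x v : G x \in unitmx -> differentiable u x ->
  inner (G x) (grad G u x) v = 'D_v u x.
Proof.
move=> Gu du; rewrite /inner /grad mulmxKV // mxE.
rewrite deriveE // {2}(row_sum_delta v) linear_sum /=.
by apply: eq_bigr => j _; rewrite linearZ !mxE deriveE // mulrC.
Qed.

Definition hess N u A C : point -> R := fun x =>
  dirder A (dirder C u) x - dirder (N A C) u x.

Definition laplacian G N u : point -> R := fun x =>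
  gtrace (G x) (fun v w => hess N u (cst v) (cst w) x).

Definition divergence G N P : point -> R := fun x =>
  gtrace (G x) (fun v w => inner (G x) (N (cst v) P x) w).

End Local.

(* Vector fields, metrics and connections on a manifold are families indexed by
   the charts, the member of index i living on [cimg i]. *)
Section Global.
Context {R : realType} {n : nat}.
Variable M : manifold R n.

Definition field_family := chart M -> 'rV[R]_n -> 'rV[R]_n.
Definition metric_family := chart M -> 'rV[R]_n -> 'M[R]_n.
Definition connection_family :=
  chart M -> ('rV[R]_n -> 'rV[R]_n) -> ('rV[R]_n -> 'rV[R]_n) ->
  ('rV[R]_n -> 'rV[R]_n).

Definition vector_field (X : field_family) :=
  (forall i, smooth_mx (cimg i) (X i)) /\
  (forall i j x, overlap i j x ->
    X j (transition i j x) = 'd (transition i j) x (X i x)).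

Record riemannian (g : metric_family) : Prop := Riemannian {
  metric_smooth : forall i, smooth_mx (cimg i) (g i);
  metric_sym : forall i x, cimg i x -> (g i x)^T = g i x;
  metric_pos : forall i x v, cimg i x -> v != 0 ->
    0 < inner (g i x) v v;
  metric_change : forall i j x v w, overlap i j x ->
    inner (g i x) v w =
    inner (g j (transition i j x))
      ('d (transition i j) x v) ('d (transition i j) x w)
}.

(* The Levi-Civita connection of an open subset being unique, the members of
   the family automatically agree on overlaps. *)
Definition levi_civita (g : metric_family) (nabla : connection_family) :=
  forall i, levi_civita_on (cimg i) (g i) (nabla i).

End Global.

Section DoublyWarpedProduct.
Context {R : realType} {n1 n2 : nat}.
Variables (B : manifold R n1) (F : manifold R n2).

Definition dwp_metric (gB : metric_family B) (gF : metric_family F)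
    (f : F -> R) (h : B -> R) : metric_family (prod_manifold B F) :=
  fun (c : chart B * chart F) z =>
    f (chart_inv c.2 (rsubmx z)) ^+ 2 *: block_mx (gB c.1 (lsubmx z)) 0 0 0 +
    h (chart_inv c.1 (lsubmx z)) ^+ 2 *: block_mx 0 0 0 (gF c.2 (rsubmx z)).

Definition lift_field (P : field_family F) :
    field_family (prod_manifold B F) :=
  fun (c : chart B * chart F) z => row_mx 0 (P c.2 (rsubmx z)).

End DoublyWarpedProduct.

(* The metrics induced by G on the leaves through x and y tangent to the first,
   resp. second, factor. *)
Definition leaf1 (R : realType) (n1 n2 : nat)
    (G : 'rV[R]_(n1 + n2) -> 'M[R]_(n1 + n2)) (y : 'rV[R]_n2) :
    'rV[R]_n1 -> 'M[R]_n1 := fun x => ulsubmx (G (row_mx x y)).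

Definition leaf2 (R : realType) (n1 n2 : nat)
    (G : 'rV[R]_(n1 + n2) -> 'M[R]_(n1 + n2)) (x : 'rV[R]_n1) :
    'rV[R]_n2 -> 'M[R]_n2 := fun y => drsubmx (G (row_mx x y)).

(* Main.v *)
(* Every tensor is evaluated on coordinate vector fields and with its indices
   lowered. If N is the Levi-Civita connection of G then
     G(R(a,c)e, w) = D_a G(N_c e, w) - D_c G(N_a e, w)
                     - G(N_c e, N_a w) + G(N_a e, N_c w),
   and Koszul's formula expresses G(N_v w, u) by derivatives of G. For the
   doubly warped metric Koszul's formula is explicit in terms of the factors, so
   that the curvature follows without differentiating an inverse matrix or a
   gradient. As the metric is block diagonal, the double trace giving the scalar
   curvature r only involves components with a, w tangent to one factor and c, e
   tangent to one factor. The semi-symmetric metric connection of P has scalar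
   curvature r - 2(n-1) div P - (n-1)(n-2) pi(P), on M as on the leaf of F, and
   div_M P = div_F P + n1 P(f)/f. *)

Require Import Defs.
From HB Require Import structures.
From mathcomp Require Import all_boot all_order all_algebra.
From mathcomp Require Import boolp classical_sets functions cardinality.
From mathcomp Require Import reals topology normedtype derive.
From mathcomp Require Import landau ring.

Set Implicit Arguments.
Unset Strict Implicit.
Unset Printing Implicit Defensive.

Import Order.TTheory GRing.Theory Num.Theory.
Import numFieldNormedType.Exports.

Local Open Scope classical_set_scope.
Local Open Scope ring_scope.

(** * Calculus of smooth functions on an open set *)

Lemma near_eq_differentiable (R : numFieldType) (V W : normedModType R)
    (f g : V -> W) (x : V) :
  (\forall y \near x, f y = g y) -> differentiable f x -> differentiable g x.
Proof.
move=> fg /diff_locallyP[dfc /eqaddoP dfo].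
(* [f] and [g] agree near [x], so the first-order expansion of [f] is also one of [g]; uniqueness of
   the differential then gives ['d g x = 'd f x]. *)
have gx : g \o shift x = cst (g x) + 'd f x +o_ 0 id.
  have fg0 : \forall y \near 0, f (y + x) = g (y + x).
    by move: fg; rewrite (near_shift 0); apply: filterS => y /=; rewrite subr0.
  apply/eqaddoP => e e0; apply: filterS2 fg0 (dfo e e0) => y fgy.
  by rewrite !fctE /= fgy (nbhs_singleton fg).
apply/diff_locallyP; split; last by rewrite (diff_unique dfc gx).
by rewrite (diff_unique dfc gx).
Qed.

Section SmoothCalculus.
Context {R : realType} {n : nat}.
Implicit Types (D : set 'rV[R]_n) (u w : 'rV[R]_n -> R).

Lemma derive_eq_on D (W : normedModType R) (u w : 'rV[R]_n -> W) v x :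
  open D -> (forall y, D y -> u y = w y) -> D x -> 'D_v u x = 'D_v w x.
Proof.
move=> oD uw Dx; apply: near_eq_derive.
by apply: filterS (open_nbhs_nbhs (conj oD Dx)) => y; exact: uw.
Qed.

(** The rules for derivatives of sums and products hold only on [D], not as equalities of functions.
    As [D] is open, [Ck] sees only the values on [D], so the rules can still be used inside it. *)
Lemma eq_Ck D k u w : open D -> (forall x, D x -> u x = w x) ->
  Ck k D u -> Ck k D w.
Proof.
move=> oD; elim: k u w => [|k IH] u w uw /=.
  move=> uc x Dx; have := uc x Dx; rewrite /prop_for /continuous_at (uw x Dx).
  have nuw : \forall y \near x, u y = w y.
    by apply: filterS (open_nbhs_nbhs (conj oD Dx)) => y; exact: uw.
  by apply: cvg_trans; exact: (near_eq_cvg nuw).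
move=> [ud uk]; split=> [x Dx|v].
  apply: near_eq_differentiable (ud x Dx).
  by apply: filterS (open_nbhs_nbhs (conj oD Dx)) => y; exact: uw.
by apply: IH (uk v) => x Dx; exact: derive_eq_on oD uw Dx.
Qed.

Lemma CkW D k u : Ck k.+1 D u -> Ck k D u.
Proof.
elim: k u => [|k IH] u [ud uk] /=.
  by move=> x Dx; exact: differentiable_continuous (ud x Dx).
by split=> // v; apply: IH; exact: uk.
Qed.

Lemma Ck_cst D k (a : R) : Ck k D (fun=> a).
Proof.
elim: k a => [|k IH] a /=; first by move=> x _; exact: cst_continuous.
split=> [x _|v]; first exact: differentiable_cst.
rewrite (_ : (fun x => 'D_v _ x) = (fun=> 0)); first exact: IH.
by apply/funext => x; exact: derive_cst.
Qed.

Lemma CkD D k u w : open D -> Ck k D u -> Ck k D w ->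
  Ck k D (fun x => u x + w x).
Proof.
move=> oD; elim: k u w => [|k IH] u w /=.
  by move=> uc wc x Dx; exact: (cvgD (uc x Dx) (wc x Dx)).
move=> [ud uk] [wd wk]; split=> [x Dx|v].
  by apply: differentiableD; [exact: ud|exact: wd].
apply: eq_Ck (IH _ _ (uk v) (wk v)) => // x Dx; apply/esym.
by apply: deriveD; apply: diff_derivable; [exact: ud|exact: wd].
Qed.

Lemma CkM D k u w : open D -> Ck k D u -> Ck k D w ->
  Ck k D (fun x => u x * w x).
Proof.
move=> oD; elim: k u w => [|k IH] u w /=.
  by move=> uc wc x Dx; exact: (cvgM (uc x Dx) (wc x Dx)).
(* The derivative of the product contains [u] and [w] undifferentiated, and the induction hypothesis
   needs these at the lower order [k]. *)
move=> uk1 wk1; have [uk wk] := (CkW uk1, CkW wk1).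
case: uk1 wk1 => [ud duk] [wd dwk]; split=> [x Dx|v].
  by apply: differentiableM; [exact: ud|exact: wd].
apply: eq_Ck (CkD oD (IH _ _ uk (dwk v)) (IH _ _ wk (duk v))) => // x Dx.
by apply/esym/deriveM; apply: diff_derivable; [exact: ud|exact: wd].
Qed.

Variables (D : set 'rV[R]_n).
Hypothesis oD : open D.

Lemma smooth_cst (a : R) : smooth D (fun=> a).
Proof. by move=> k; exact: Ck_cst. Qed.

Lemma smoothD u w : smooth D u -> smooth D w -> smooth D (fun x => u x + w x).
Proof. by move=> su sw k; exact: CkD. Qed.

Lemma smoothM u w : smooth D u -> smooth D w -> smooth D (fun x => u x * w x).
Proof. by move=> su sw k; exact: CkM. Qed.

Lemma smoothN u : smooth D u -> smooth D (fun x => - u x).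
Proof.
move=> su; rewrite (_ : (fun x => _) = (fun x => -1 * u x)).
  by apply: smoothM => //; exact: smooth_cst.
by apply/funext => x; rewrite mulN1r.
Qed.

Lemma smooth_sum (I : Type) (s : seq I) (u : I -> 'rV[R]_n -> R) :
  (forall i, smooth D (u i)) -> smooth D (fun x => \sum_(i <- s) u i x).
Proof.
move=> su; elim: s => [|i s IH].
  under eq_fun do rewrite big_nil; exact: smooth_cst.
by under eq_fun do rewrite big_cons; exact: smoothD.
Qed.

Lemma smooth_derive u v : smooth D u -> smooth D (fun x => 'D_v u x).
Proof. by move=> su k; have [_] := su k.+1; exact. Qed.

Lemma smooth_differentiable u x : smooth D u -> D x -> differentiable u x.
Proof. by move=> su Dx; have [ud _] := su 1%N; exact: ud. Qed.

Lemma smooth_derivable u x v : smooth D u -> D x -> derivable u x v.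
Proof. by move=> su Dx; exact/diff_derivable/smooth_differentiable. Qed.

Lemma smooth_mx_cst p q (A : 'M[R]_(p, q)) : smooth_mx D (fun=> A).
Proof. by move=> i j; exact: smooth_cst. Qed.

Lemma smooth_mxD p q (A C : 'rV[R]_n -> 'M[R]_(p, q)) :
  smooth_mx D A -> smooth_mx D C -> smooth_mx D (A \+ C).
Proof.
by move=> sA sC i j; under eq_fun do rewrite mxE; exact: smoothD.
Qed.

Lemma smooth_mxZ p q u (A : 'rV[R]_n -> 'M[R]_(p, q)) :
  smooth D u -> smooth_mx D A -> smooth_mx D (fun x => u x *: A x).
Proof.
by move=> su sA i j; under eq_fun do rewrite mxE; exact: smoothM.
Qed.

Lemma smooth_inner p (G : 'rV[R]_n -> 'M[R]_p) (A C : 'rV[R]_n -> 'rV[R]_p) :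
  smooth_mx D G -> smooth_mx D A -> smooth_mx D C ->
  smooth D (fun x => inner (G x) (A x) (C x)).
Proof.
move=> sG sA sC; under eq_fun do rewrite /inner mxE.
apply: smooth_sum => j; apply: smoothM; last first.
  by under eq_fun do rewrite mxE; exact: sC.
under eq_fun do rewrite mxE.
by apply: smooth_sum => i; apply: smoothM; [exact: sA|exact: sG].
Qed.

End SmoothCalculus.

(** * Inner products and metric traces *)

Section InnerProduct.
Context {R : realType} {n : nat}.
Implicit Types (g : 'M[R]_n) (v w a : 'rV[R]_n).

Lemma innerDl g v v' w : inner g (v + v') w = inner g v w + inner g v' w.
Proof. by rewrite /inner !mulmxDl mxE. Qed.

Lemma innerDr g v w w' : inner g v (w + w') = inner g v w + inner g v w'.
Proof. by rewrite /inner linearD mulmxDr mxE. Qed.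

Lemma inner_delta g v j : inner g v (delta_mx 0 j) = (v *m g) 0 j.
Proof. by rewrite /inner trmx_delta -colE mxE. Qed.

Lemma inner0l g w : inner g 0 w = 0.
Proof. by rewrite /inner !mul0mx mxE. Qed.

Lemma inner0r g v : inner g v 0 = 0.
Proof. by rewrite /inner trmx0 mulmx0 mxE. Qed.

Lemma innerZl g k v w : inner g (k *: v) w = k * inner g v w.
Proof. by rewrite /inner -!scalemxAl mxE. Qed.

Lemma innerZr g k v w : inner g v (k *: w) = k * inner g v w.
Proof. by rewrite /inner linearZ /= -scalemxAr mxE. Qed.

Lemma innerNl g v w : inner g (- v) w = - inner g v w.
Proof. by rewrite -scaleN1r innerZl mulN1r. Qed.

Lemma innerNr g v w : inner g v (- w) = - inner g v w.
Proof. by rewrite -scaleN1r innerZr mulN1r. Qed.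

Lemma innerBl g v v' w : inner g (v - v') w = inner g v w - inner g v' w.
Proof. by rewrite innerDl innerNl. Qed.

Lemma inner_scalemx g k v w : inner (k *: g) v w = k * inner g v w.
Proof. by rewrite /inner -scalemxAr -scalemxAl mxE. Qed.

Lemma inner_sym g v w : g^T = g -> inner g v w = inner g w v.
Proof.
move=> gs; rewrite /inner; transitivity ((v *m g *m w^T)^T 0 0).
  by rewrite [RHS]mxE.
by rewrite !trmx_mul trmxK gs mulmxA.
Qed.

Lemma inner_inj g v v' : g \in unitmx ->
  (forall w, inner g v w = inner g v' w) -> v = v'.
Proof.
move=> gu vv'; apply: (can_inj (mulmxK gu)); apply/rowP => j.
by rewrite -!inner_delta vv'.
Qed.

(** A nonzero row of the kernel of [g] would be a nonzero vector of square length zero. *)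
Lemma pos_unitmx g : (forall v, v != 0 -> 0 < inner g v v) -> g \in unitmx.
Proof.
move=> gpos; rewrite -row_free_unit -kermx_eq0; apply/negPn/negP => k0.
have [i ki] : exists i, row i (kermx g) != 0.
  apply/existsP; apply: contraR k0 => /existsPn k0; apply/eqP/row_matrixP => i.
  by rewrite row0; apply/eqP; rewrite -[_ == _]negbK; exact: k0.
have := gpos _ ki; rewrite /inner -row_mul mulmx_ker row0 mul0mx mxE.
by rewrite ltxx.
Qed.

Lemma invmx_sym g : g^T = g -> (invmx g)^T = invmx g.
Proof. by rewrite trmx_inv => ->. Qed.

Lemma eq_gtrace g (S T : 'rV[R]_n -> 'rV[R]_n -> R) :
  (forall v w, S v w = T v w) -> gtrace g S = gtrace g T.
Proof.
by move=> ST; apply: eq_bigr => i _; apply: eq_bigr => j _; rewrite ST.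
Qed.

Lemma gtraceD g S T :
  gtrace g (fun v w => S v w + T v w) = gtrace g S + gtrace g T.
Proof.
rewrite /gtrace -big_split; apply: eq_bigr => i _; rewrite -big_split.
by apply: eq_bigr => j _; rewrite mulrDr.
Qed.

Lemma gtraceZ g k T : gtrace g (fun v w => k * T v w) = k * gtrace g T.
Proof.
rewrite /gtrace mulr_sumr; apply: eq_bigr => i _; rewrite mulr_sumr.
by apply: eq_bigr => j _; rewrite mulrCA.
Qed.

Lemma gtraceN g T : gtrace g (fun v w => - T v w) = - gtrace g T.
Proof.
by rewrite -mulN1r -gtraceZ; apply: eq_gtrace => v w; rewrite mulN1r.
Qed.

Lemma gtraceB g S T :
  gtrace g (fun v w => S v w - T v w) = gtrace g S - gtrace g T.
Proof. by rewrite gtraceD gtraceN. Qed.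

Lemma gtrace_scalemx g k T : k != 0 -> g \in unitmx ->
  gtrace (k *: g) T = k^-1 * gtrace g T.
Proof.
move=> k0 gu; rewrite /gtrace invmxZ ?unitmxZ ?unitfE// mulr_sumr.
apply: eq_bigr => i _; rewrite mulr_sumr.
by apply: eq_bigr => j _; rewrite mxE mulrA.
Qed.

(** Raising the index lowered by [g] gives back [L]. This turns the trace that defines the Ricci
    tensor into a metric trace of lowered components. *)
Lemma gtrace_form g (L : 'rV[R]_n -> 'rV[R]_n) : g^T = g -> g \in unitmx ->
  gtrace g (fun v w => inner g (L v) w) = \tr (lin1_mx L).
Proof.
move=> gs gu; rewrite /gtrace /mxtrace; apply: eq_bigr => i _.
rewrite mxE -{2}[L _](mulmxK gu) [RHS]mxE; apply: eq_bigr => j _.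
rewrite inner_delta mulrC; congr (_ * _).
by rewrite -[in LHS](invmx_sym gs) mxE.
Qed.

Lemma gtrace_inner g : g^T = g -> g \in unitmx -> gtrace g (inner g) = n%:R.
Proof.
move=> gs gu; rewrite (gtrace_form id) // -(mxtrace1 R n); congr (\tr _).
by apply/matrixP => i j; rewrite !mxE eqxx eq_sym.
Qed.

(** By symmetry of [g] the form comes from the rank-one endomorphism sending [v] to [phi v *: c],
    whose trace is [phi c]. *)
Lemma gtrace_rank1 g (phi : 'rV[R]_n -> R) c : g^T = g -> g \in unitmx ->
  (forall k v w, phi (k *: v + w) = k * phi v + phi w) ->
  gtrace g (fun v w => phi v * inner g w c) = phi c.
Proof.
move=> gs gu philin.
have phi0 : phi 0 = 0.
  by have := philin (-1) 0 0; rewrite scaleN1r addNr mulN1r addNr.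
have phiD v w : phi (v + w) = phi v + phi w.
  by have := philin 1 v w; rewrite scale1r mul1r.
rewrite [in RHS](row_sum_delta c) (big_morph phi phiD phi0).
rewrite (@eq_gtrace _ _ (fun v w => inner g (phi v *: c) w)); last first.
  by move=> v w; rewrite innerZl (inner_sym w).
rewrite gtrace_form//; apply: eq_bigr => j _.
by rewrite !mxE -[in RHS](addr0 (_ *: _)) philin phi0 addr0 mulrC.
Qed.

Lemma gtrace_inner2 g a c : g^T = g -> g \in unitmx ->
  gtrace g (fun v w => inner g v a * inner g w c) = inner g a c.
Proof.
move=> gs gu.
rewrite (@gtrace_rank1 _ (inner g ^~ a)) //; first exact: inner_sym.
by move=> k v w; rewrite innerDl innerZl.
Qed.

Lemma gtrace_shift g T k l : g^T = g -> g \in unitmx ->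
  gtrace g (fun v w => k * T v w + l * inner g v w) =
  k * gtrace g T + l * n%:R.
Proof. by move=> gs gu; rewrite gtraceD !gtraceZ gtrace_inner. Qed.

(** The form is a lowered curvature tensor of constant curvature one, contracted over its outer
    arguments. The squared gradients enter [dwp_curv1111] and [dwp_curv2222] as factors of such
    tensors. *)
Lemma gtrace_const_curv g a c : g^T = g -> g \in unitmx ->
  gtrace g (fun v w => inner g a c * inner g v w - inner g v c * inner g a w) =
  (n%:R - 1) * inner g a c.
Proof.
move=> gs gu; rewrite gtraceB gtraceZ gtrace_inner//.
rewrite (@eq_gtrace _ _ (fun v w => inner g v c * inner g w a)); last first.
  by move=> v w; rewrite (inner_sym a).
by rewrite gtrace_inner2// (inner_sym a)//; ring.
Qed.

End InnerProduct.

(** * Block diagonal metrics *)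

Section BlockTrace.
Context {R : realType} {n1 n2 : nat}.
Variables (A : 'M[R]_n1) (C : 'M[R]_n2).

Lemma inner_block v w : inner (block_mx A 0 0 C) v w =
  inner A (lsubmx v) (lsubmx w) + inner C (rsubmx v) (rsubmx w).
Proof.
rewrite /inner -{1}(hsubmxK v) -{1}(hsubmxK w) mul_row_block tr_row_mx.
by rewrite mul_row_col !mulmx0 addr0 add0r mxE.
Qed.

Hypotheses (Au : A \in unitmx) (Cu : C \in unitmx).

Lemma mul_block_inv :
  block_mx A 0 0 C *m block_mx (invmx A) 0 0 (invmx C) = 1%:M.
Proof.
rewrite mulmx_block !mul0mx !mulmx0 !addr0 !add0r !mulmxV//.
by rewrite -scalar_mx_block.
Qed.

Lemma block_unitmx : block_mx A 0 0 C \in unitmx.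
Proof. by have [] := mulmx1_unit mul_block_inv. Qed.

(** The inverse of a block diagonal matrix is block diagonal, so the mixed components of [T] get
    coefficient zero. *)
Lemma gtrace_block T : gtrace (block_mx A 0 0 C) T =
  gtrace A (fun v w => T (row_mx v 0) (row_mx w 0)) +
  gtrace C (fun v w => T (row_mx 0 v) (row_mx 0 w)).
Proof.
rewrite /gtrace.
have -> : invmx (block_mx A 0 0 C) = block_mx (invmx A) 0 0 (invmx C).
  by rewrite -[in LHS](mulmx1 (invmx _)) -mul_block_inv mulKmx// block_unitmx.
rewrite big_split_ord; congr (_ + _); apply: eq_bigr => i _;
  rewrite big_split_ord /=.
- rewrite [X in _ + X]big1 ?addr0 => [|j _]; last first.
    by rewrite block_mxEur mxE mul0r.
  by apply: eq_bigr => j _; rewrite block_mxEul !delta_mx_lshift.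
- rewrite [X in X + _]big1 ?add0r => [|j _]; last first.
    by rewrite block_mxEdl mxE mul0r.
  by apply: eq_bigr => j _; rewrite block_mxEdr !delta_mx_rshift.
Qed.

End BlockTrace.

(** * Levi-Civita connection and curvature on constant fields *)

Section LeviCivita.
Context {R : realType} {n : nat}.
Variables (D : set 'rV[R]_n) (G : 'rV[R]_n -> 'M[R]_n).
Variable N : ('rV[R]_n -> 'rV[R]_n) -> ('rV[R]_n -> 'rV[R]_n) ->
  ('rV[R]_n -> 'rV[R]_n).
Hypotheses (oD : open D) (G_smooth : smooth_mx D G).
Hypothesis G_sym : forall x, D x -> (G x)^T = G x.
Hypothesis G_unit : forall x, D x -> G x \in unitmx.
Hypothesis LC : levi_civita_on D G N.
Implicit Types (a c e v w : 'rV[R]_n) (C E : 'rV[R]_n -> 'rV[R]_n).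

Let aff : affine_connection D N. Proof. by case: LC. Qed.

Lemma bracket_cst a c : bracket (cst a) (cst c) = cst 0 :> ('rV[R]_n -> _).
Proof. by apply/funext => x; rewrite /bracket !derive_cst subrr. Qed.

Lemma conn0l C x : smooth_mx D C -> D x -> N (cst 0) C x = 0.
Proof.
move=> sC Dx.
have := conn_scalel aff (smooth_cst D 0) (smooth_mx_cst D 0) sC Dx.
by rewrite !scale0r.
Qed.

Lemma conn_cst_sym v w x : D x -> N (cst v) (cst w) x = N (cst w) (cst v) x.
Proof.
move=> Dx; apply/subr0_eq; have [_ tf _] := LC.
by rewrite tf ?bracket_cst //; exact: smooth_mx_cst.
Qed.

Lemma conn_cst_smooth v w : smooth_mx D (N (cst v) (cst w)).
Proof. by apply: conn_smooth aff _ _ _ _; exact: smooth_mx_cst. Qed.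

Lemma conn_cst_linear k v w C x : smooth_mx D C -> D x ->
  N (cst (k *: v + w)) C x = k *: N (cst v) C x + N (cst w) C x.
Proof.
move=> sC Dx; have sv := smooth_mx_cst D v; have sw := smooth_mx_cst D w.
have sk := smooth_cst D k.
rewrite -(conn_scalel aff sk sv sC Dx) -(conn_addl aff _ sw sC Dx) //.
by apply: smooth_mxZ.
Qed.

Lemma conn_cst0l w x : D x -> N (cst 0) (cst w) x = 0.
Proof. by move=> Dx; apply: conn0l Dx; exact: smooth_mx_cst. Qed.

Lemma conn_cst0r v x : D x -> N (cst v) (cst 0) x = 0.
Proof. by move=> Dx; rewrite conn_cst_sym// conn_cst0l. Qed.

Lemma derive_inner v C E x : smooth_mx D C -> smooth_mx D E -> D x ->
  'D_v (fun y => inner (G y) (C y) (E y)) x =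
  inner (G x) (N (cst v) C x) (E x) + inner (G x) (C x) (N (cst v) E x).
Proof.
move=> sC sE Dx; have [_ _ mc] := LC.
by rewrite -mc//; exact: smooth_mx_cst.
Qed.

(** Metric compatibility turns the three derivatives into six connection terms. Constant fields
    commute, so the connection is symmetric on them: two terms coincide and the other four
    cancel. *)
Lemma koszul v w u x : D x ->
  2 * inner (G x) (N (cst v) (cst w) x) u =
  'D_v (fun y => inner (G y) w u) x + 'D_w (fun y => inner (G y) v u) x -
  'D_u (fun y => inner (G y) v w) x.
Proof.
move=> Dx.
rewrite (derive_inner v (smooth_mx_cst D w) (smooth_mx_cst D u) Dx).
rewrite (derive_inner w (smooth_mx_cst D v) (smooth_mx_cst D u) Dx).
rewrite (derive_inner u (smooth_mx_cst D v) (smooth_mx_cst D w) Dx) /=.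
rewrite (conn_cst_sym w v Dx) (conn_cst_sym u v Dx) (conn_cst_sym u w Dx).
rewrite (inner_sym (N (cst v) (cst u) x) w (G_sym Dx)).
ring.
Qed.

(** Metric compatibility is applied to the pairing of an inner covariant derivative with the
    constant field [w]; the bracket term drops because constant fields commute. *)
Lemma curv_lower a c e w x : D x ->
  inner (G x) (curv N (cst a) (cst c) (cst e) x) w =
  'D_a (fun y => inner (G y) (N (cst c) (cst e) y) w) x -
  'D_c (fun y => inner (G y) (N (cst a) (cst e) y) w) x -
  inner (G x) (N (cst c) (cst e) x) (N (cst a) (cst w) x) +
  inner (G x) (N (cst a) (cst e) x) (N (cst c) (cst w) x).
Proof.
move=> Dx; rewrite /curv bracket_cst conn0l ?subr0//; last exact: smooth_mx_cst.
rewrite innerBl.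
rewrite (derive_inner a (conn_cst_smooth c e) (smooth_mx_cst D w) Dx).
rewrite (derive_inner c (conn_cst_smooth a e) (smooth_mx_cst D w) Dx) /=.
ring.
Qed.

(** Stated for an arbitrary [K], so as to serve both the Levi-Civita and the semi-symmetric
    connection. *)
Lemma ricci_gtrace K c e x : D x ->
  ricci K (cst c) (cst e) x =
  gtrace (G x) (fun a w => inner (G x) (curv K (cst a) (cst c) (cst e) x) w).
Proof.
by move=> Dx; rewrite gtrace_form //; [exact: G_sym|exact: G_unit].
Qed.

(** * Curvature of the semi-symmetric metric connection *)

Section SemiSymmetric.
Variable P : 'rV[R]_n -> 'rV[R]_n.
Hypothesis P_smooth : smooth_mx D P.

Let pi v x := inner (G x) v (P x).

Lemma curv_semisym a c e x : D x ->
  curv (semisym G N P) (cst a) (cst c) (cst e) x =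
  curv N (cst a) (cst c) (cst e) x +
  inner (G x) e (N (cst a) P x) *: c - inner (G x) c e *: N (cst a) P x +
  (pi e x * pi c x) *: a - (inner (G x) c e * pi (P x) x) *: a +
  (inner (G x) c e * pi a x) *: P x -
  (inner (G x) e (N (cst c) P x) *: a - inner (G x) a e *: N (cst c) P x +
  (pi e x * pi a x) *: c - (inner (G x) a e * pi (P x) x) *: c +
  (inner (G x) a e * pi c x) *: P x).
Proof.
move=> Dx.
(* Apart from the iterated derivative [N (cst b) (N (cst d) (cst e))], the terms where [N]
   differentiates a constant field are together symmetric in [b] and [d], and so is the term
   [pi e x * inner (G x) b d]. They disappear from the curvature. *)
have semi2 b d : semisym G N P (cst b) (semisym G N P (cst d) (cst e)) x =
    N (cst b) (N (cst d) (cst e)) x +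
    (inner (G x) (N (cst b) (cst e) x) (P x) + inner (G x) e (N (cst b) P x))
      *: d + pi e x *: N (cst b) (cst d) x -
    (inner (G x) (N (cst b) (cst d) x) e + inner (G x) d (N (cst b) (cst e) x))
      *: P x - inner (G x) d e *: N (cst b) P x +
    (pi (N (cst d) (cst e) x) x + pi e x * pi d x -
      inner (G x) d e * pi (P x) x) *: b -
    (inner (G x) b (N (cst d) (cst e) x) + pi e x * inner (G x) b d -
      inner (G x) d e * pi b x) *: P x.
  rewrite {1}/semisym.
  (* The connection laws concern sums and multiples, so the minus sign is absorbed into the
     coefficient of [P]. *)
  have -> : semisym G N P (cst d) (cst e) =
      (N (cst d) (cst e) \+ (fun y => inner (G y) e (P y) *: cst d y)) \+
      (fun y => - inner (G y) d e *: P y).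
    by apply/funext => y; rewrite /= /semisym scaleNr.
  have sd := smooth_mx_cst D d; have se := smooth_mx_cst D e.
  have sb := smooth_mx_cst D b.
  have su1 : smooth D (fun y => inner (G y) e (P y)) by exact: smooth_inner.
  have su2 : smooth D (fun y => - inner (G y) d e).
    by apply: smoothN => //; exact: smooth_inner.
  have sX1 := conn_cst_smooth d e.
  have sX2 := smooth_mxZ oD su1 sd; have sX3 := smooth_mxZ oD su2 P_smooth.
  rewrite (conn_addr aff sb (smooth_mxD oD sX1 sX2) sX3 Dx).
  rewrite (conn_addr aff sb sX1 sX2 Dx).
  rewrite (conn_leibniz aff su1 sb sd Dx) (conn_leibniz aff su2 sb P_smooth Dx).
  rewrite /dirder deriveN; last first.
    by apply: smooth_derivable Dx; exact: smooth_inner.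
  rewrite (derive_inner b se P_smooth Dx) (derive_inner b sd se Dx) /=.
  rewrite !(innerDl, innerDr, innerNl, innerNr, innerZl, innerZr) /= /pi.
  by apply/rowP => k; rewrite !mxE; ring.
rewrite {1}/curv !semi2 bracket_cst /curv.
have -> : semisym G N P (cst 0) (cst e) x = 0.
  rewrite /semisym conn0l//=; last exact: smooth_mx_cst.
  by rewrite scaler0 inner0l scale0r subr0 addr0.
rewrite bracket_cst (conn0l (smooth_mx_cst D e) Dx) (conn_cst_sym c a Dx) /pi.
rewrite (inner_sym a (N (cst c) (cst e) x) (G_sym Dx)).
rewrite (inner_sym c (N (cst a) (cst e) x) (G_sym Dx)).
rewrite (inner_sym a c (G_sym Dx)).
by apply/rowP => k; rewrite !mxE; ring.
Qed.

(** The trace of [curv_semisym] over [a]. In each factor [n%:R - 2] the dimension is the trace of a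
    multiple of the identity, and the 2 collects two rank-one terms. *)
Lemma ricci_semisym c e x : D x ->
  ricci (semisym G N P) (cst c) (cst e) x =
  ricci N (cst c) (cst e) x -
  (n%:R - 2) * inner (G x) (N (cst c) P x) e -
  divergence G N P x * inner (G x) c e +
  (n%:R - 2) * (pi c x * pi e x) - (n%:R - 2) * pi (P x) x * inner (G x) c e.
Proof.
move=> Dx; have Gs := G_sym Dx; have Gu := G_unit Dx.
rewrite (ricci_gtrace N)// (ricci_gtrace (semisym _ _ _))//.
set k := inner (G x) c e; set q := pi (P x) x.
rewrite (@eq_gtrace _ _ _ _ (fun a w =>
  inner (G x) (curv N (cst a) (cst c) (cst e) x) w +
  inner (G x) (N (cst a) P x) e * inner (G x) w c -
  k * inner (G x) (N (cst a) P x) w +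
  (pi e x * pi c x - k * q - inner (G x) (N (cst c) P x) e) *
    inner (G x) a w +
  k * (inner (G x) a (P x) * inner (G x) w (P x)) +
  inner (G x) a e * inner (G x) w (N (cst c) P x) -
  pi e x * (inner (G x) a (P x) * inner (G x) w c) +
  q * (inner (G x) a e * inner (G x) w c) -
  pi c x * (inner (G x) a e * inner (G x) w (P x)))); last first.
  move=> a w; rewrite curv_semisym//; move: (curv N _ _ _ _) => r.
  rewrite !(innerDl, innerNl, innerZl) -/k -/q /pi.
  rewrite (inner_sym e (N (cst a) P x) Gs) (inner_sym e (N (cst c) P x) Gs).
  rewrite (inner_sym w c Gs) (inner_sym w (N (cst c) P x) Gs).
  rewrite (inner_sym w (P x) Gs).
  ring.
rewrite !(gtraceD, gtraceN, gtraceZ, gtrace_inner2) //.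
rewrite (@gtrace_rank1 _ _ _ (fun a => inner (G x) (N (cst a) P x) e))//;
  last first.
  by move=> t v v'; rewrite conn_cst_linear// innerDl innerZl.
rewrite gtrace_inner// -/(divergence G N P x) (inner_sym e c Gs) -/k.
rewrite (inner_sym (P x) c Gs) (inner_sym e (N (cst c) P x) Gs) /q /pi.
ring.
Qed.

(** In the trace of [ricci_semisym] the divergence receives [-(n - 2)] from the derivative term and
    [-n] from the metric term. The square length of [P] receives [n - 2] and [-n (n - 2)]. *)
Theorem scal_semisym x : D x ->
  scal G (semisym G N P) x =
  scal G N x - 2 * (n%:R - 1) * divergence G N P x -
  (n%:R - 1) * (n%:R - 2) * inner (G x) (P x) (P x).
Proof.
move=> Dx; have Gs := G_sym Dx; have Gu := G_unit Dx.
rewrite /scal (@eq_gtrace _ _ _ _ (fun c e => ricci N (cst c) (cst e) x -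
  (n%:R - 2) * inner (G x) (N (cst c) P x) e -
  divergence G N P x * inner (G x) c e +
  (n%:R - 2) * (inner (G x) c (P x) * inner (G x) e (P x)) -
  (n%:R - 2) * inner (G x) (P x) (P x) * inner (G x) c e)); last first.
  by move=> c e; rewrite ricci_semisym.
rewrite !(gtraceD, gtraceN, gtraceZ, gtrace_inner2) // gtrace_inner//.
rewrite -/(divergence G N P x).
ring.
Qed.

End SemiSymmetric.

End LeviCivita.

(** * Differentiation on a product domain *)

Section ProductCalculus.
Context {R : realType} {n1 n2 : nat}.
Variables (D1 : set 'rV[R]_n1) (D2 : set 'rV[R]_n2).
Hypotheses (oD1 : open D1) (oD2 : open D2).

Definition prod_dom : set 'rV[R]_(n1 + n2) :=
  (lsubmx @^-1` D1) `&` (rsubmx @^-1` D2).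

Lemma prod_dom_open : open prod_dom.
Proof.
apply: openI; apply: open_comp => // z _.
- exact: continuous_lsubmx.
- exact: continuous_rsubmx.
Qed.

Lemma smooth_lsubmx (u : 'rV[R]_n1 -> R) : smooth D1 u ->
  smooth prod_dom (fun z => u (lsubmx z)).
Proof.
move=> su k; apply: (@Ck_sub _ _ k _ (lsubmx @^-1` D1)) => [z []//|].
by apply: (Ck_comp_linear (L := lsubmx)) (su k); exact: continuous_lsubmx.
Qed.

Lemma smooth_rsubmx (u : 'rV[R]_n2 -> R) : smooth D2 u ->
  smooth prod_dom (fun z => u (rsubmx z)).
Proof.
move=> su k; apply: (@Ck_sub _ _ k _ (rsubmx @^-1` D2)) => [z []//|].
by apply: (Ck_comp_linear (L := rsubmx)) (su k); exact: continuous_rsubmx.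
Qed.

(** Since [lsubmx] is linear, the two difference quotients are the same function of the
    increment. *)
Lemma derive_lsubmx (u : 'rV[R]_n1 -> R) v (z : 'rV[R]_(n1 + n2)) :
  'D_v (fun z => u (lsubmx z)) z = 'D_(lsubmx v) u (lsubmx z).
Proof.
rewrite /derive; set a := (X in lim (X @ _)); set b := (X in _ = lim (X @ _)).
suff -> : a = b by [].
by apply/funext => t; rewrite /a /b /= linearP.
Qed.

Lemma derive_rsubmx (u : 'rV[R]_n2 -> R) v (z : 'rV[R]_(n1 + n2)) :
  'D_v (fun z => u (rsubmx z)) z = 'D_(rsubmx v) u (rsubmx z).
Proof.
rewrite /derive; set a := (X in lim (X @ _)); set b := (X in _ = lim (X @ _)).
suff -> : a = b by [].
by apply/funext => t; rewrite /a /b /= linearP.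
Qed.

(** The components of the warped metric and of its lowered connection are built from products of
    this shape, a function on the first factor times one on the second. *)
Lemma derive_prod (a : 'rV[R]_n1 -> R) (b : 'rV[R]_n2 -> R) v z :
  smooth D1 a -> smooth D2 b -> prod_dom z ->
  'D_v (fun z => a (lsubmx z) * b (rsubmx z)) z =
  'D_(lsubmx v) a (lsubmx z) * b (rsubmx z) +
  a (lsubmx z) * 'D_(rsubmx v) b (rsubmx z).
Proof.
move=> sa sb Dz.
rewrite deriveM; last 2 first.
- exact: smooth_derivable (smooth_lsubmx sa) Dz.
- exact: smooth_derivable (smooth_rsubmx sb) Dz.
by rewrite derive_lsubmx derive_rsubmx addrC [X in X + _ = _]mulrC.
Qed.

End ProductCalculus.

Lemma derive_sqr (R : realType) n (D : set 'rV[R]_n) (u : 'rV[R]_n -> R) v x :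
  smooth D u -> D x -> 'D_v (fun y => u y ^+ 2) x = 2 * u x * 'D_v u x.
Proof.
move=> su Dx; have du : derivable u x v := smooth_derivable su Dx.
rewrite (_ : (fun y => u y ^+ 2) = u * u) ?deriveM //.
by rewrite /GRing.scale /=; ring.
Qed.

(** * The doubly warped metric in one product chart *)

Section DoublyWarped.
Context {R : realType} {n1 n2 : nat}.
Variables (D1 : set 'rV[R]_n1) (D2 : set 'rV[R]_n2).
Variables (G1 : 'rV[R]_n1 -> 'M[R]_n1) (G2 : 'rV[R]_n2 -> 'M[R]_n2).
Variables (h : 'rV[R]_n1 -> R) (f : 'rV[R]_n2 -> R).
Variable N1 : ('rV[R]_n1 -> 'rV[R]_n1) -> ('rV[R]_n1 -> 'rV[R]_n1) ->
  ('rV[R]_n1 -> 'rV[R]_n1).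
Variable N2 : ('rV[R]_n2 -> 'rV[R]_n2) -> ('rV[R]_n2 -> 'rV[R]_n2) ->
  ('rV[R]_n2 -> 'rV[R]_n2).
Variable N : ('rV[R]_(n1 + n2) -> 'rV[R]_(n1 + n2)) ->
  ('rV[R]_(n1 + n2) -> 'rV[R]_(n1 + n2)) ->
  ('rV[R]_(n1 + n2) -> 'rV[R]_(n1 + n2)).
Local Notation D := (prod_dom D1 D2).
Local Notation inl := (fun v : 'rV[R]_n1 => row_mx v (0 : 'rV[R]_n2)).
Local Notation inr := (fun v : 'rV[R]_n2 => row_mx (0 : 'rV[R]_n1) v).

(** The member of [dwp_metric] for a single product chart, where [h] and [f] stand for the warping
    functions already composed with the inverse charts. *)
Definition dwp z : 'M[R]_(n1 + n2) :=
  f (rsubmx z) ^+ 2 *: block_mx (G1 (lsubmx z)) 0 0 0 +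
  h (lsubmx z) ^+ 2 *: block_mx 0 0 0 (G2 (rsubmx z)).

Hypotheses (oD1 : open D1) (oD2 : open D2).
Hypotheses (G1_smooth : smooth_mx D1 G1) (G2_smooth : smooth_mx D2 G2).
Hypothesis G1_sym : forall x, D1 x -> (G1 x)^T = G1 x.
Hypothesis G2_sym : forall y, D2 y -> (G2 y)^T = G2 y.
Hypothesis G1_unit : forall x, D1 x -> G1 x \in unitmx.
Hypothesis G2_unit : forall y, D2 y -> G2 y \in unitmx.
Hypotheses (h_smooth : smooth D1 h) (f_smooth : smooth D2 f).
Hypothesis h_neq0 : forall x, D1 x -> h x != 0.
Hypothesis f_neq0 : forall y, D2 y -> f y != 0.
Hypothesis LC1 : levi_civita_on D1 G1 N1.
Hypothesis LC2 : levi_civita_on D2 G2 N2.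
Hypothesis LC : levi_civita_on D dwp N.

Lemma dwp_block z : dwp z =
  block_mx (f (rsubmx z) ^+ 2 *: G1 (lsubmx z)) 0
    0 (h (lsubmx z) ^+ 2 *: G2 (rsubmx z)).
Proof.
by rewrite /dwp !scale_block_mx add_block_mx !scaler0 !addr0 add0r.
Qed.

Lemma inner_dwp z v w : inner (dwp z) v w =
  inner (G1 (lsubmx z)) (lsubmx v) (lsubmx w) * f (rsubmx z) ^+ 2 +
  h (lsubmx z) ^+ 2 * inner (G2 (rsubmx z)) (rsubmx v) (rsubmx w).
Proof. by rewrite dwp_block inner_block !inner_scalemx [X in X + _]mulrC. Qed.

Lemma dwp_sym z : D z -> (dwp z)^T = dwp z.
Proof.
move=> [Dx Dy]; rewrite dwp_block tr_block_mx !linear0 !linearZ /=.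
by rewrite G1_sym// G2_sym.
Qed.

Let dwp_block1 z : D z -> f (rsubmx z) ^+ 2 *: G1 (lsubmx z) \in unitmx.
Proof.
by move=> [Dx Dy]; rewrite unitmxZ ?G1_unit// unitfE expf_neq0// f_neq0.
Qed.

Let dwp_block2 z : D z -> h (lsubmx z) ^+ 2 *: G2 (rsubmx z) \in unitmx.
Proof.
by move=> [Dx Dy]; rewrite unitmxZ ?G2_unit// unitfE expf_neq0// h_neq0.
Qed.

Lemma dwp_unit z : D z -> dwp z \in unitmx.
Proof.
move=> Dz; rewrite dwp_block.
exact: block_unitmx (dwp_block1 Dz) (dwp_block2 Dz).
Qed.

Lemma dwp_smooth : smooth_mx D dwp.
Proof.
have sf2 : smooth D2 (fun y => f y ^+ 2).
  by under eq_fun do rewrite expr2; exact: smoothM.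
have sh2 : smooth D1 (fun x => h x ^+ 2).
  by under eq_fun do rewrite expr2; exact: smoothM.
have oD := prod_dom_open oD1 oD2.
move=> i j; under eq_fun do rewrite dwp_block.
rewrite -(splitK i) -(splitK j).
case: (fintype.split i) (fintype.split j) => k [] l /=;
  under eq_fun do
    rewrite ?(block_mxEul, block_mxEur, block_mxEdl, block_mxEdr) mxE.
- apply: smoothM => //; first exact: (smooth_rsubmx D1 sf2).
  exact: (smooth_lsubmx D2 (G1_smooth k l)).
- exact: smooth_cst.
- exact: smooth_cst.
- apply: smoothM => //; first exact: (smooth_lsubmx D2 sh2).
  exact: (smooth_rsubmx D1 (G2_smooth k l)).
Qed.

Lemma gtrace_dwp z T : D z -> gtrace (dwp z) T =
  gtrace (G1 (lsubmx z)) (fun v w => T (inl v) (inl w)) / f (rsubmx z) ^+ 2 +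
  gtrace (G2 (rsubmx z)) (fun v w => T (inr v) (inr w)) / h (lsubmx z) ^+ 2.
Proof.
move=> Dz; have [Dx Dy] := Dz.
rewrite dwp_block gtrace_block ?dwp_block1 ?dwp_block2//.
rewrite !gtrace_scalemx ?expf_neq0 ?h_neq0 ?f_neq0 ?G1_unit ?G2_unit//.
by congr (_ + _); rewrite mulrC.
Qed.

(** [G1] is scaled by a function on the second factor and [G2] by one on the first. The derivatives
    of [G1] and [G2] therefore reassemble into Koszul's formula for [N1] and [N2], and the rest
    comes from differentiating the squares of [f] and [h]. *)
Lemma dwp_koszul z v w u : D z ->
  inner (dwp z) (N (cst v) (cst w) z) u =
  let x := lsubmx z in let y := rsubmx z in
  f y ^+ 2 * inner (G1 x) (N1 (cst (lsubmx v)) (cst (lsubmx w)) x) (lsubmx u) +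
  h x ^+ 2 * inner (G2 y) (N2 (cst (rsubmx v)) (cst (rsubmx w)) y) (rsubmx u) +
  f y * ('D_(rsubmx v) f y * inner (G1 x) (lsubmx w) (lsubmx u) +
         'D_(rsubmx w) f y * inner (G1 x) (lsubmx v) (lsubmx u) -
         'D_(rsubmx u) f y * inner (G1 x) (lsubmx v) (lsubmx w)) +
  h x * ('D_(lsubmx v) h x * inner (G2 y) (rsubmx w) (rsubmx u) +
         'D_(lsubmx w) h x * inner (G2 y) (rsubmx v) (rsubmx u) -
         'D_(lsubmx u) h x * inner (G2 y) (rsubmx v) (rsubmx w)).
Proof.
move=> Dz /=; set x := lsubmx z; set y := rsubmx z.
have [Dx Dy] := Dz.
have sI1 a b : smooth D1 (fun x => inner (G1 x) a b).
  by apply: smooth_inner => //; exact: smooth_mx_cst.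
have sI2 a b : smooth D2 (fun y => inner (G2 y) a b).
  by apply: smooth_inner => //; exact: smooth_mx_cst.
have sf2 : smooth D2 (fun y => f y ^+ 2).
  by under eq_fun do rewrite expr2; exact: smoothM.
have sh2 : smooth D1 (fun x => h x ^+ 2).
  by under eq_fun do rewrite expr2; exact: smoothM.
have dI a b d : 'D_d (fun z => inner (dwp z) a b) z =
    f y ^+ 2 * 'D_(lsubmx d) (fun x => inner (G1 x) (lsubmx a) (lsubmx b)) x +
    h x ^+ 2 * 'D_(rsubmx d) (fun y => inner (G2 y) (rsubmx a) (rsubmx b)) y +
    2 * f y * 'D_(rsubmx d) f y * inner (G1 x) (lsubmx a) (lsubmx b) +
    2 * h x * 'D_(lsubmx d) h x * inner (G2 y) (rsubmx a) (rsubmx b).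
  under eq_fun do rewrite inner_dwp.
  rewrite deriveD; last 2 first.
  - apply: (smooth_derivable _ Dz); apply: smoothM => //.
    + exact: prod_dom_open.
    + exact: (smooth_lsubmx D2 (sI1 _ _)).
    + exact: (smooth_rsubmx D1 sf2).
  - apply: (smooth_derivable _ Dz); apply: smoothM => //.
    + exact: prod_dom_open.
    + exact: (smooth_lsubmx D2 sh2).
    + exact: (smooth_rsubmx D1 (sI2 _ _)).
  rewrite (derive_prod _ (sI1 _ _) sf2 Dz) (derive_prod _ sh2 (sI2 _ _) Dz).
  rewrite (derive_sqr _ f_smooth Dy) (derive_sqr _ h_smooth Dx) -/x -/y.
  ring.
have two0 : (2 : R) != 0 by rewrite pnatr_eq0.
apply: (mulfI two0); rewrite (koszul dwp_sym LC v w u Dz) !dI.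
have K1 := koszul G1_sym LC1 (lsubmx v) (lsubmx w) (lsubmx u) Dx.
have K2 := koszul G2_sym LC2 (rsubmx v) (rsubmx w) (rsubmx u) Dy.
rewrite !mulrDr [2 * (f y ^+ 2 * _)]mulrCA [2 * (h x ^+ 2 * _)]mulrCA K1 K2.
rewrite -/x -/y.
do !move: (derive _ _ _) => ?; do !move: (inner _ _ _) => ?.
move: (f y) (h x) => *; ring.
Qed.

(** * Gradients and the connection on lifted constant fields *)

Let fM (z : 'rV[R]_(n1 + n2)) := f (rsubmx z).
Let hM (z : 'rV[R]_(n1 + n2)) := h (lsubmx z).

Lemma inner_grad_f z v : D z ->
  inner (dwp z) (grad dwp fM z) v = 'D_(rsubmx v) f (rsubmx z).
Proof.
move=> Dz; rewrite inner_grad ?dwp_unit// ?derive_rsubmx//.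
exact: smooth_differentiable (smooth_rsubmx D1 f_smooth) Dz.
Qed.

Lemma inner_grad_h z v : D z ->
  inner (dwp z) (grad dwp hM z) v = 'D_(lsubmx v) h (lsubmx z).
Proof.
move=> Dz; rewrite inner_grad ?dwp_unit// ?derive_lsubmx//.
exact: smooth_differentiable (smooth_lsubmx D2 h_smooth) Dz.
Qed.

Let inner_inl z s u :
  inner (dwp z) (inl s) u =
  f (rsubmx z) ^+ 2 * inner (G1 (lsubmx z)) s (lsubmx u).
Proof. by rewrite inner_dwp row_mxKl row_mxKr inner0l mulr0 addr0 mulrC. Qed.

Let inner_inr z t u :
  inner (dwp z) (inr t) u =
  h (lsubmx z) ^+ 2 * inner (G2 (rsubmx z)) t (rsubmx u).
Proof. by rewrite inner_dwp row_mxKl row_mxKr inner0l mul0r add0r. Qed.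

(** Vector forms of the connection are needed for the products of two connection values in
    [curv_lower]. The gradient is known through its pairings only, which is enough for nondegeneracy
    of the metric to give the equality. *)
Lemma dwp_conn11 z c e : D z -> N (cst (inl c)) (cst (inl e)) z =
  inl (N1 (cst c) (cst e) (lsubmx z)) -
  (f (rsubmx z) * inner (G1 (lsubmx z)) c e) *: grad dwp fM z.
Proof.
move=> Dz; apply: (inner_inj (dwp_unit Dz)) => u.
rewrite dwp_koszul //= innerBl innerZl inner_grad_f// inner_inl.
rewrite !(row_mxKl, row_mxKr) !derive0 !(inner0l, inner0r).
rewrite (conn_cst0l LC2) ?inner0l; last by case: Dz.
ring.
Qed.

Lemma dwp_conn22 z b w : D z -> N (cst (inr b)) (cst (inr w)) z =
  inr (N2 (cst b) (cst w) (rsubmx z)) -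
  (h (lsubmx z) * inner (G2 (rsubmx z)) b w) *: grad dwp hM z.
Proof.
move=> Dz; apply: (inner_inj (dwp_unit Dz)) => u.
rewrite dwp_koszul //= innerBl innerZl inner_grad_h// inner_inr.
rewrite !(row_mxKl, row_mxKr) !derive0 !(inner0l, inner0r).
rewrite (conn_cst0l LC1) ?inner0l; last by case: Dz.
ring.
Qed.

Lemma dwp_conn12 z c b : D z -> N (cst (inl c)) (cst (inr b)) z =
  inl (('D_b f (rsubmx z) / f (rsubmx z)) *: c) +
  inr (('D_c h (lsubmx z) / h (lsubmx z)) *: b).
Proof.
move=> Dz; have [Dx Dy] := Dz; apply: (inner_inj (dwp_unit Dz)) => u.
rewrite dwp_koszul //= innerDl inner_inl inner_inr !innerZl.
rewrite !(row_mxKl, row_mxKr) !derive0 !(inner0l, inner0r).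
rewrite (conn_cst0l LC2 _ Dy) (conn_cst0r LC1 _ Dx) !inner0l.
by field; rewrite h_neq0 ?f_neq0.
Qed.

Let derive_on (W : normedModType R) (u w : 'rV[R]_(n1 + n2) -> W) v z :
  (forall z, D z -> u z = w z) -> D z -> 'D_v u z = 'D_v w z.
Proof. exact: derive_eq_on (prod_dom_open oD1 oD2). Qed.

Let f2_smooth : smooth D2 (fun y => f y ^+ 2).
Proof. by under eq_fun do rewrite expr2; exact: smoothM. Qed.

Let h2_smooth : smooth D1 (fun x => h x ^+ 2).
Proof. by under eq_fun do rewrite expr2; exact: smoothM. Qed.

(** This and the next five formulas are written as a function of [lsubmx z] times a function of
    [rsubmx z], in the order that [derive_prod] expects. *)
Lemma dwp_koszul11_1 z c e w : D z ->
  inner (dwp z) (N (cst (inl c)) (cst (inl e)) z) (inl w) =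
  inner (G1 (lsubmx z)) (N1 (cst c) (cst e) (lsubmx z)) w * f (rsubmx z) ^+ 2.
Proof.
move=> Dz; rewrite dwp_koszul //= !(row_mxKl, row_mxKr) !derive0.
by rewrite !inner0r; ring.
Qed.

Lemma dwp_koszul11_2 z c e w : D z ->
  inner (dwp z) (N (cst (inl c)) (cst (inl e)) z) (inr w) =
  inner (G1 (lsubmx z)) c e * - (f (rsubmx z) * 'D_w f (rsubmx z)).
Proof.
move=> Dz; rewrite dwp_koszul //= !(row_mxKl, row_mxKr) !derive0.
rewrite (conn_cst0l LC2) ?inner0l; last by case: Dz.
by rewrite !inner0r; ring.
Qed.

Lemma dwp_koszul22_2 z b v w : D z ->
  inner (dwp z) (N (cst (inr b)) (cst (inr v)) z) (inr w) =
  h (lsubmx z) ^+ 2 * inner (G2 (rsubmx z)) (N2 (cst b) (cst v) (rsubmx z)) w.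
Proof.
move=> Dz; rewrite dwp_koszul //= !(row_mxKl, row_mxKr) !derive0.
by rewrite !inner0r; ring.
Qed.

Lemma dwp_koszul22_1 z b w e : D z ->
  inner (dwp z) (N (cst (inr b)) (cst (inr w)) z) (inl e) =
  - (h (lsubmx z) * 'D_e h (lsubmx z)) * inner (G2 (rsubmx z)) b w.
Proof.
move=> Dz; rewrite dwp_koszul //= !(row_mxKl, row_mxKr) !derive0.
rewrite (conn_cst0l LC1) ?inner0l; last by case: Dz.
by rewrite !inner0r; ring.
Qed.

Lemma dwp_koszul12_1 z c b w : D z ->
  inner (dwp z) (N (cst (inl c)) (cst (inr b)) z) (inl w) =
  inner (G1 (lsubmx z)) c w * (f (rsubmx z) * 'D_b f (rsubmx z)).
Proof.
move=> Dz; rewrite dwp_conn12// innerDl inner_inl inner_inr.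
rewrite !(row_mxKl, row_mxKr) !innerZl inner0r.
by case: Dz => Dx Dy; field; rewrite h_neq0 ?f_neq0.
Qed.

Lemma dwp_koszul12_2 z c b w : D z ->
  inner (dwp z) (N (cst (inl c)) (cst (inr b)) z) (inr w) =
  (h (lsubmx z) * 'D_c h (lsubmx z)) * inner (G2 (rsubmx z)) b w.
Proof.
move=> Dz; rewrite dwp_conn12// innerDl inner_inl inner_inr.
rewrite !(row_mxKl, row_mxKr) !innerZl inner0r.
by case: Dz => Dx Dy; field; rewrite h_neq0 ?f_neq0.
Qed.

Let inner1_smooth (s : 'rV[R]_n1 -> 'rV[R]_n1) w : smooth_mx D1 s ->
  smooth D1 (fun x => inner (G1 x) (s x) w).
Proof. by move=> ss; apply: smooth_inner => //; exact: smooth_mx_cst. Qed.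

Let inner2_smooth (s : 'rV[R]_n2 -> 'rV[R]_n2) w : smooth_mx D2 s ->
  smooth D2 (fun x => inner (G2 x) (s x) w).
Proof. by move=> ss; apply: smooth_inner => //; exact: smooth_mx_cst. Qed.

(** [f] is constant along the first factor, so its gradient is tangent to the second. This makes the
    gradients of [f] and [h] orthogonal in [inner_conn11_22]. *)
Lemma lsubmx_grad_f z : D z -> lsubmx (grad dwp fM z) = 0.
Proof.
move=> Dz; have [Dx Dy] := Dz; apply: (inner_inj (G1_unit Dx)) => s.
have := inner_grad_f (inl s) Dz.
rewrite row_mxKr derive0 (inner_sym _ _ (dwp_sym Dz)) inner_inl.
move=> /eqP; rewrite mulf_eq0 expf_eq0 /= (negPf (f_neq0 Dy)) /= => /eqP.
by rewrite (inner_sym _ _ (G1_sym Dx)) inner0l.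
Qed.

Let inner_inl_inr z s t : inner (dwp z) (inl s) (inr t) = 0.
Proof. by rewrite inner_inl row_mxKl inner0r mulr0. Qed.

Let inner_grad_f_inl z s : D z -> inner (dwp z) (grad dwp fM z) (inl s) = 0.
Proof. by move=> Dz; rewrite inner_grad_f// row_mxKr derive0. Qed.

Let inner_grad_h_inr z t : D z -> inner (dwp z) (grad dwp hM z) (inr t) = 0.
Proof. by move=> Dz; rewrite inner_grad_h// row_mxKl derive0. Qed.

(** * Pairings of connection values and components of the curvature *)

Let inner_conn11_11 z b d b' d' : D z ->
  inner (dwp z) (N (cst (inl b)) (cst (inl d)) z)
    (N (cst (inl b')) (cst (inl d')) z) =
  f (rsubmx z) ^+ 2 * inner (G1 (lsubmx z))
    (N1 (cst b) (cst d) (lsubmx z)) (N1 (cst b') (cst d') (lsubmx z)) +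
  f (rsubmx z) ^+ 2 * inner (dwp z) (grad dwp fM z) (grad dwp fM z) *
    (inner (G1 (lsubmx z)) b d * inner (G1 (lsubmx z)) b' d').
Proof.
move=> Dz; rewrite !dwp_conn11// !(innerDl, innerNl, innerZl).
rewrite !(innerDr, innerNr, innerZr).
rewrite (inner_sym (inl _) (grad _ _ _) (dwp_sym Dz)) !inner_grad_f_inl//.
by rewrite inner_inl row_mxKl; ring.
Qed.

Let inner_conn22_22 z b d b' d' : D z ->
  inner (dwp z) (N (cst (inr b)) (cst (inr d)) z)
    (N (cst (inr b')) (cst (inr d')) z) =
  h (lsubmx z) ^+ 2 * inner (G2 (rsubmx z))
    (N2 (cst b) (cst d) (rsubmx z)) (N2 (cst b') (cst d') (rsubmx z)) +
  h (lsubmx z) ^+ 2 * inner (dwp z) (grad dwp hM z) (grad dwp hM z) *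
    (inner (G2 (rsubmx z)) b d * inner (G2 (rsubmx z)) b' d').
Proof.
move=> Dz; rewrite !dwp_conn22// !(innerDl, innerNl, innerZl).
rewrite !(innerDr, innerNr, innerZr).
rewrite (inner_sym (inr _) (grad _ _ _) (dwp_sym Dz)) !inner_grad_h_inr//.
by rewrite inner_inr row_mxKr; ring.
Qed.

Let inner_conn11_22 z c e b w : D z ->
  inner (dwp z) (N (cst (inl c)) (cst (inl e)) z)
    (N (cst (inr b)) (cst (inr w)) z) =
  - (h (lsubmx z) * inner (G2 (rsubmx z)) b w *
     'D_(N1 (cst c) (cst e) (lsubmx z)) h (lsubmx z)) -
  f (rsubmx z) * inner (G1 (lsubmx z)) c e *
     'D_(N2 (cst b) (cst w) (rsubmx z)) f (rsubmx z).
Proof.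
move=> Dz; rewrite dwp_conn11// dwp_conn22// !(innerDl, innerNl, innerZl).
rewrite !(innerDr, innerNr, innerZr) inner_inl_inr.
rewrite (inner_sym (inl _) (grad _ _ _) (dwp_sym Dz)) inner_grad_h//.
rewrite (inner_sym (grad _ fM _) (grad _ hM _) (dwp_sym Dz)) inner_grad_h//.
rewrite inner_grad_f// row_mxKl row_mxKr lsubmx_grad_f// derive0.
by ring.
Qed.

Let inner_conn12_12 z c b e w : D z ->
  inner (dwp z) (N (cst (inl c)) (cst (inr b)) z)
    (N (cst (inl e)) (cst (inr w)) z) =
  'D_b f (rsubmx z) * 'D_w f (rsubmx z) * inner (G1 (lsubmx z)) c e +
  'D_c h (lsubmx z) * 'D_e h (lsubmx z) * inner (G2 (rsubmx z)) b w.
Proof.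
move=> Dz; have [Dx Dy] := Dz; have Gs := dwp_sym Dz.
rewrite !dwp_conn12// !(innerDl, innerDr) !inner_inl_inr.
rewrite (inner_sym (inr _) (inl _) Gs) inner_inl_inr inner_inl inner_inr.
rewrite row_mxKl row_mxKr !innerZl !innerZr.
by field; rewrite h_neq0 ?f_neq0.
Qed.

(** This is the Gauss equation of a leaf of the first factor. The leaf is umbilic: by [dwp_conn11]
    its second fundamental form is a multiple of the leaf metric times the gradient of [f]. *)
Lemma dwp_curv1111 z a c e w : D z ->
  inner (dwp z) (curv N (cst (inl a)) (cst (inl c)) (cst (inl e)) z) (inl w) =
  f (rsubmx z) ^+ 2 *
    inner (G1 (lsubmx z)) (curv N1 (cst a) (cst c) (cst e) (lsubmx z)) w -
  f (rsubmx z) ^+ 2 * inner (dwp z) (grad dwp fM z) (grad dwp fM z) *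
    (inner (G1 (lsubmx z)) c e * inner (G1 (lsubmx z)) a w -
     inner (G1 (lsubmx z)) a e * inner (G1 (lsubmx z)) c w).
Proof.
move=> Dz; have [Dx Dy] := Dz.
rewrite (curv_lower LC)// (curv_lower LC1)//.
have dE b d : 'D_(inl b) (fun z => inner (dwp z)
      (N (cst (inl d)) (cst (inl e)) z) (inl w)) z =
    'D_b (fun x => inner (G1 x) (N1 (cst d) (cst e) x) w) (lsubmx z) *
    f (rsubmx z) ^+ 2.
  rewrite (derive_on _ (fun z Dz => dwp_koszul11_1 d e w Dz))//.
  rewrite (derive_prod _ (inner1_smooth w (conn_cst_smooth LC1 d e))
    f2_smooth Dz).
  by rewrite row_mxKl row_mxKr derive0 mulr0 addr0.
rewrite !dE !inner_conn11_11//.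
do !move: (derive _ _ _) => ?; do !move: (inner _ _ _) => ?.
by move: (f _) => ?; ring.
Qed.

Lemma dwp_curv2222 z a c e w : D z ->
  inner (dwp z) (curv N (cst (inr a)) (cst (inr c)) (cst (inr e)) z) (inr w) =
  h (lsubmx z) ^+ 2 *
    inner (G2 (rsubmx z)) (curv N2 (cst a) (cst c) (cst e) (rsubmx z)) w -
  h (lsubmx z) ^+ 2 * inner (dwp z) (grad dwp hM z) (grad dwp hM z) *
    (inner (G2 (rsubmx z)) c e * inner (G2 (rsubmx z)) a w -
     inner (G2 (rsubmx z)) a e * inner (G2 (rsubmx z)) c w).
Proof.
move=> Dz; have [Dx Dy] := Dz.
rewrite (curv_lower LC)// (curv_lower LC2)//.
have dE b d : 'D_(inr b) (fun z => inner (dwp z)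
      (N (cst (inr d)) (cst (inr e)) z) (inr w)) z =
    h (lsubmx z) ^+ 2 *
    'D_b (fun y => inner (G2 y) (N2 (cst d) (cst e) y) w) (rsubmx z).
  rewrite (derive_on _ (fun z Dz => dwp_koszul22_2 d e w Dz))//.
  rewrite (derive_prod _ h2_smooth
    (inner2_smooth w (conn_cst_smooth LC2 d e)) Dz).
  by rewrite row_mxKl row_mxKr derive0 mul0r add0r.
rewrite !dE !inner_conn22_22//.
do !move: (derive _ _ _) => ?; do !move: (inner _ _ _) => ?.
by move: (h _) => ?; ring.
Qed.

Let derive_fDf b w y : D2 y ->
  'D_b (fun y => f y * 'D_w f y) y =
  'D_b f y * 'D_w f y + f y * 'D_b (fun y => 'D_w f y) y.
Proof.
move=> Dy; rewrite deriveM; last 2 first.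
- exact: smooth_derivable f_smooth Dy.
- exact: smooth_derivable (smooth_derive w f_smooth) Dy.
by rewrite addrC [X in X + _ = _]mulrC.
Qed.

Let derive_hDh c e x : D1 x ->
  'D_c (fun x => h x * 'D_e h x) x =
  'D_c h x * 'D_e h x + h x * 'D_c (fun x => 'D_e h x) x.
Proof.
move=> Dx; rewrite deriveM; last 2 first.
- exact: smooth_derivable h_smooth Dx.
- exact: smooth_derivable (smooth_derive e h_smooth) Dx.
by rewrite addrC [X in X + _ = _]mulrC.
Qed.

Let fDf_smooth w : smooth D2 (fun y => f y * 'D_w f y).
Proof. by apply: smoothM => //; exact: smooth_derive. Qed.

Let hDh_smooth e : smooth D1 (fun x => h x * 'D_e h x).
Proof. by apply: smoothM => //; exact: smooth_derive. Qed.

(** The products of first derivatives cancel against [inner_conn12_12], and the terms of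
    [inner_conn11_22] complete the second derivatives of [f] and [h] to Hessians. *)
Lemma dwp_curv1221 z c b w e : D z ->
  inner (dwp z) (curv N (cst (inl c)) (cst (inr b)) (cst (inr w)) z) (inl e) =
  - (f (rsubmx z) * inner (G1 (lsubmx z)) c e *
     hess N2 f (cst b) (cst w) (rsubmx z)) -
  h (lsubmx z) * inner (G2 (rsubmx z)) b w *
    hess N1 h (cst c) (cst e) (lsubmx z).
Proof.
move=> Dz; have [Dx Dy] := Dz; have Gs := dwp_sym Dz.
rewrite (curv_lower LC)// (derive_on _ (fun z Dz => dwp_koszul22_1 b w e Dz))//.
rewrite (derive_on _ (fun z Dz => dwp_koszul12_1 c w e Dz))//.
rewrite (derive_prod _ (smoothN oD1 (hDh_smooth e))
  (inner2_smooth w (smooth_mx_cst D2 b)) Dz).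
rewrite (derive_prod _ (inner1_smooth e (smooth_mx_cst D1 c))
  (fDf_smooth w) Dz).
rewrite !(row_mxKl, row_mxKr) !derive0 deriveN; last first.
  exact: smooth_derivable (hDh_smooth e) Dx.
rewrite derive_hDh// derive_fDf//.
rewrite (inner_sym (N (cst (inr b)) (cst (inr w)) z) _ Gs) inner_conn11_22//.
rewrite (conn_cst_sym LC (inr b)) // inner_conn12_12// /hess /dirder /=.
rewrite (inner_sym w b (G2_sym Dy)).
do !move: (derive _ _ _) => ?; do !move: (inner _ _ _) => ?.
by move: (f _) (h _) => *; ring.
Qed.

(** The same value as in [dwp_curv1221], as the antisymmetry of the curvature in each pair of
    arguments predicts; it results from the same cancellation. *)
Lemma dwp_curv2112 z b c e w : D z ->
  inner (dwp z) (curv N (cst (inr b)) (cst (inl c)) (cst (inl e)) z) (inr w) =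
  - (f (rsubmx z) * inner (G1 (lsubmx z)) c e *
     hess N2 f (cst b) (cst w) (rsubmx z)) -
  h (lsubmx z) * inner (G2 (rsubmx z)) b w *
    hess N1 h (cst c) (cst e) (lsubmx z).
Proof.
move=> Dz; have [Dx Dy] := Dz; have Gs := dwp_sym Dz.
rewrite (curv_lower LC)// (derive_on _ (fun z Dz => dwp_koszul11_2 c e w Dz))//.
have k21 z' : D z' ->
    inner (dwp z') (N (cst (inr b)) (cst (inl e)) z') (inr w) =
    (h (lsubmx z') * 'D_e h (lsubmx z')) * inner (G2 (rsubmx z')) b w.
  by move=> Dz'; rewrite (conn_cst_sym LC (inr b))// dwp_koszul12_2.
rewrite (derive_on _ k21)//.
rewrite (derive_prod _ (inner1_smooth e (smooth_mx_cst D1 c))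
  (smoothN oD2 (fDf_smooth w)) Dz).
rewrite (derive_prod _ (hDh_smooth e)
  (inner2_smooth w (smooth_mx_cst D2 b)) Dz).
rewrite !(row_mxKl, row_mxKr) !derive0 deriveN; last first.
  exact: smooth_derivable (fDf_smooth w) Dy.
rewrite derive_hDh// derive_fDf// inner_conn11_22//.
rewrite (conn_cst_sym LC (inr b)) // inner_conn12_12// /hess /dirder /=.
rewrite (inner_sym e c (G1_sym Dx)).
do !move: (derive _ _ _) => ?; do !move: (inner _ _ _) => ?.
by move: (f _) (h _) => *; ring.
Qed.

(** The mixed curvature components are counted twice, in the Ricci tensor along each of the two
    factors; hence the 2 before the Laplacians. Dividing by the squared warping functions turns
    traces by [G1] and [G2] into traces by [dwp]. *)
Lemma scal_dwp z : D z ->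
  scal dwp N z =
  scal G1 N1 (lsubmx z) / f (rsubmx z) ^+ 2 +
  scal G2 N2 (rsubmx z) / h (lsubmx z) ^+ 2 -
  n1%:R * (n1%:R - 1) *
    (inner (dwp z) (grad dwp fM z) (grad dwp fM z) / f (rsubmx z) ^+ 2) -
  n2%:R * (n2%:R - 1) *
    (inner (dwp z) (grad dwp hM z) (grad dwp hM z) / h (lsubmx z) ^+ 2) -
  2 * n1%:R * (laplacian G2 N2 f (rsubmx z) / h (lsubmx z) ^+ 2 /
    f (rsubmx z)) -
  2 * n2%:R * (laplacian G1 N1 h (lsubmx z) / f (rsubmx z) ^+ 2 /
    h (lsubmx z)).
Proof.
move=> Dz; have [Dx Dy] := Dz.
have G1s := G1_sym Dx; have G1u := G1_unit Dx.
have G2s := G2_sym Dy; have G2u := G2_unit Dy.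
rewrite {1}/scal gtrace_dwp//.
set x := lsubmx z; set y := rsubmx z.
set af := inner _ (grad dwp fM z) _; set ah := inner _ (grad dwp hM z) _.
(* The factor [1] gives the first two summands the shape required by [gtrace_shift]. *)
have ric1 c e : ricci N (cst (inl c)) (cst (inl e)) z =
    1 * ricci N1 (cst c) (cst e) x +
    - ((n1%:R - 1) * af + laplacian G2 N2 f y * f y / h x ^+ 2) *
      inner (G1 x) c e +
    - (n2%:R / h x) * hess N1 h (cst c) (cst e) x.
  rewrite (ricci_gtrace dwp_sym dwp_unit)// gtrace_dwp//.
  rewrite (@eq_gtrace _ _ _ _ (fun a w =>
    f y ^+ 2 * inner (G1 x) (curv N1 (cst a) (cst c) (cst e) x) w -
    f y ^+ 2 * af * (inner (G1 x) c e * inner (G1 x) a w -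
      inner (G1 x) a e * inner (G1 x) c w))); last first.
    by move=> a w; rewrite dwp_curv1111.
  rewrite gtraceB !gtraceZ gtrace_const_curv// -(ricci_gtrace G1_sym G1_unit)//.
  rewrite [X in _ + X / _](@eq_gtrace _ _ _ _ (fun b w =>
    - (f y * inner (G1 x) c e) * hess N2 f (cst b) (cst w) y +
    - (h x * hess N1 h (cst c) (cst e) x) * inner (G2 y) b w)); last first.
    by move=> b w; rewrite dwp_curv2112// -/x -/y; ring.
  rewrite gtrace_shift// -/(laplacian G2 N2 f y) -/x -/y.
  by field; rewrite h_neq0 ?f_neq0.
have ric2 b w : ricci N (cst (inr b)) (cst (inr w)) z =
    1 * ricci N2 (cst b) (cst w) y +
    - ((n2%:R - 1) * ah + laplacian G1 N1 h x * h x / f y ^+ 2) *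
      inner (G2 y) b w +
    - (n1%:R / f y) * hess N2 f (cst b) (cst w) y.
  rewrite (ricci_gtrace dwp_sym dwp_unit)// gtrace_dwp//.
  rewrite (@eq_gtrace _ _ _ _ (fun c e =>
    - (h x * inner (G2 y) b w) * hess N1 h (cst c) (cst e) x +
    - (f y * hess N2 f (cst b) (cst w) y) * inner (G1 x) c e)); last first.
    by move=> c e; rewrite dwp_curv1221// -/x -/y; ring.
  rewrite gtrace_shift// -/(laplacian G1 N1 h x).
  rewrite [X in _ + X / _](@eq_gtrace _ _ _ _ (fun a v =>
    h x ^+ 2 * inner (G2 y) (curv N2 (cst a) (cst b) (cst w) y) v -
    h x ^+ 2 * ah * (inner (G2 y) b w * inner (G2 y) a v -
      inner (G2 y) a w * inner (G2 y) b v))); last first.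
    by move=> a v; rewrite dwp_curv2222.
  rewrite gtraceB !gtraceZ gtrace_const_curv// -(ricci_gtrace G2_sym G2_unit)//.
  rewrite -/x -/y.
  by field; rewrite h_neq0 ?f_neq0.
rewrite (eq_gtrace _ ric1) (eq_gtrace _ ric2).
rewrite !(gtraceD _ (fun _ _ => _ * _ + _)) !gtrace_shift// !gtraceZ.
rewrite -/(laplacian G1 N1 h x) -/(laplacian G2 N2 f y).
rewrite -/(scal G1 N1 x) -/(scal G2 N2 y).
by field; rewrite h_neq0 ?f_neq0.
Qed.

(** * Divergence of the lifted field and the semi-symmetric scalar curvature *)

Variable P : 'rV[R]_n2 -> 'rV[R]_n2.
Hypothesis P_smooth : smooth_mx D2 P.

Let PM (z : 'rV[R]_(n1 + n2)) : 'rV[R]_(n1 + n2) := row_mx 0 (P (rsubmx z)).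

Lemma lift_smooth : smooth_mx D PM.
Proof.
move=> i j; rewrite -(splitK j); case: (fintype.split j) => k /=.
  by under eq_fun do rewrite row_mxEl mxE; exact: smooth_cst.
by under eq_fun do rewrite row_mxEr; exact: (smooth_rsubmx D1 (P_smooth i k)).
Qed.

(** Along the first factor the derivative of the lift of [P] is pure scaling at rate [P(f)/f], with
    trace [n1] times that rate. Along the second factor the square of [h] is constant and cancels
    against the inverse metric. *)
Lemma divergence_dwp z : D z ->
  divergence dwp N PM z = divergence G2 N2 P (rsubmx z) +
  n1%:R * ('D_(P (rsubmx z)) f (rsubmx z) / f (rsubmx z)).
Proof.
move=> Dz; have [Dx Dy] := Dz; have Gs := dwp_sym Dz.
set x := lsubmx z; set y := rsubmx z.
(* Metric compatibility moves the derivative off [PM], so that the connection acts on constant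
   fields only, as in the Koszul lemmas. *)
have conn_PM v w : inner (dwp z) (N (cst v) PM z) w =
    'D_v (fun z => inner (dwp z) (PM z) w) z -
    inner (dwp z) (N (cst v) (cst w) z) (PM z).
  rewrite (derive_inner LC v lift_smooth (smooth_mx_cst D w) Dz).
  by rewrite (inner_sym (PM z) _ Gs) addrK.
rewrite /divergence gtrace_dwp//.
rewrite (@eq_gtrace _ _ _ _ (fun a w =>
  f y * 'D_(P y) f y * inner (G1 x) a w)); last first.
  move=> a w; rewrite conn_PM dwp_koszul11_2//.
  rewrite (derive_on (w := cst 0)) ?derive_cst// => [|z' _]; first by ring.
  by rewrite inner_inr row_mxKr inner0r mulr0.
rewrite [X in _ + X / _](@eq_gtrace _ _ _ _ (fun b w =>
  h x ^+ 2 * inner (G2 y) (N2 (cst b) P y) w)); last first.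
  move=> b w; rewrite conn_PM dwp_koszul22_2//.
  rewrite (derive_on (w := fun z => h (lsubmx z) ^+ 2 *
    inner (G2 (rsubmx z)) (P (rsubmx z)) w))//; last first.
    by move=> z' _; rewrite inner_inr row_mxKr.
  rewrite (derive_prod _ h2_smooth (inner2_smooth w P_smooth) Dz).
  rewrite row_mxKl row_mxKr derive0 mul0r add0r.
  rewrite (derive_inner LC2 b P_smooth (smooth_mx_cst D2 w) Dy) /= -mulrBr.
  by rewrite (inner_sym (P _) _ (G2_sym Dy)) addrK.
rewrite !gtraceZ gtrace_inner; [|exact: G1_sym|exact: G1_unit].
by field; rewrite h_neq0 ?f_neq0.
Qed.

(** [scal_semisym] is used on the product and on the leaf of the second factor, and [scal_dwp] links
    the two Levi-Civita scalar curvatures. With [n = n1 + n2], the coefficients combine by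
    [(n - 1) - (n2 - 1) = n1] and [(n - 1)(n - 2) - (n2 - 1)(n2 - 2) = n1 (n + n2 - 3)]. *)
Lemma scal_semisym_dwp z : D z ->
  let x := lsubmx z in let y := rsubmx z in let n := (n1 + n2)%N in
  let g2 := fun y' => h x ^+ 2 *: G2 y' in
  scal dwp (semisym dwp N PM) z =
  scal G1 N1 x / f y ^+ 2 + scal G2 (semisym g2 N2 P) y / h x ^+ 2 -
  n1%:R * (n1%:R - 1) *
    (inner (dwp z) (grad dwp fM z) (grad dwp fM z) / f y ^+ 2) -
  n2%:R * (n2%:R - 1) *
    (inner (dwp z) (grad dwp hM z) (grad dwp hM z) / h x ^+ 2) -
  2 * n1%:R * (n%:R - 1) * ('D_(P y) f y / f y) -
  2 * n1%:R * (laplacian g2 N2 f y / f y) -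
  2 * n2%:R * (laplacian (fun x' => f y ^+ 2 *: G1 x') N1 h x / h x) -
  2 * n1%:R * divergence g2 N2 P y -
  n1%:R * (n%:R + n2%:R - 3) * inner (dwp z) (PM z) (PM z).
Proof.
move=> Dz x y n g2; have [Dx Dy] := Dz.
have h0 := h_neq0 Dx; have f0 := f_neq0 Dy.
have h20 : h x ^+ 2 != 0 by rewrite expf_neq0.
have f20 : f y ^+ 2 != 0 by rewrite expf_neq0.
have g2_smooth : smooth_mx D2 g2.
  by apply: smooth_mxZ => //; exact: smooth_cst.
have g2_sym y' : D2 y' -> (g2 y')^T = g2 y'.
  by move=> Dy'; rewrite /g2 linearZ /= G2_sym.
have g2_unit y' : D2 y' -> g2 y' \in unitmx.
  by move=> Dy'; rewrite unitmxZ ?unitfE// G2_unit.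
(* With [x] fixed, [g2] is a constant multiple of [G2], so both have the same Levi-Civita
   connection. *)
have LCg2 : levi_civita_on D2 g2 N2.
  have [aff tf mc] := LC2; split=> // A C E sA sC sE y' Dy'.
  rewrite /dirder; under eq_fun do rewrite inner_scalemx.
  rewrite !inner_scalemx -mulrDr -mc// /dirder deriveMl//.
  by apply: smooth_derivable Dy'; exact: smooth_inner.
(* The leaf scalar curvature in the conclusion is traced by [G2], whereas [scal_semisym] on the leaf
   traces by [g2]. *)
have scal_g2 K : scal G2 K y / h x ^+ 2 = scal g2 K y.
  by rewrite /scal gtrace_scalemx ?G2_unit// mulrC.
rewrite (scal_semisym (prod_dom_open oD1 oD2) dwp_smooth dwp_sym dwp_unit LC
  lift_smooth Dz).
rewrite scal_dwp// divergence_dwp// !scal_g2.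
rewrite (scal_semisym oD2 g2_smooth g2_sym g2_unit LCg2 P_smooth Dy).
(* In the divergence the scaling of the pairing cancels that of the inverse metric; in the
   Laplacians below only the inverse metric scales. *)
have -> : divergence g2 N2 P y = divergence G2 N2 P y.
  rewrite /divergence gtrace_scalemx ?G2_unit//.
  under eq_gtrace do rewrite inner_scalemx.
  by rewrite gtraceZ mulKf.
have -> : laplacian g2 N2 f y = laplacian G2 N2 f y / h x ^+ 2.
  by rewrite /laplacian gtrace_scalemx ?G2_unit// mulrC.
have -> : laplacian (fun x' => f y ^+ 2 *: G1 x') N1 h x =
    laplacian G1 N1 h x / f y ^+ 2.
  by rewrite /laplacian gtrace_scalemx ?G1_unit// mulrC.
have -> : inner (g2 y) (P y) (P y) = inner (dwp z) (PM z) (PM z).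
  by rewrite inner_inr row_mxKr inner_scalemx.
rewrite /n natrD -/x -/y.
by field; rewrite h0 f0.
Qed.

End DoublyWarped.

(** * Passage from a product chart to the manifolds *)

Lemma inner_ge0 (R : realType) n (g : 'M[R]_n) v :
  (forall w, w != 0 -> 0 < inner g w w) -> 0 <= inner g v v.
Proof.
move=> gpos; have [->|v0] := eqVneq v 0; first by rewrite inner0l.
exact/ltW/gpos.
Qed.

(** The identity of functions on the product is read at an arbitrary point [(p, q)], in an arbitrary
    product chart around it. *)
Theorem corollary4p8 (R : realType) (n1 n2 : nat)
    (B : manifold R n1) (F : manifold R n2)
    (gB : metric_family B) (gF : metric_family F)
    (h : B -> R) (f : F -> R) (P : field_family F)
    (nablaB : connection_family B) (nablaF : connection_family F)
    (nabla : connection_family (prod_manifold B F))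
    (gB_riem : riemannian gB) (gF_riem : riemannian gF)
    (h_smooth : smooth_fun h) (h_pos : forall p, 0 < h p)
    (f_smooth : smooth_fun f) (f_pos : forall q, 0 < f q)
    (P_field : vector_field P)
    (nablaB_LC : levi_civita gB nablaB) (nablaF_LC : levi_civita gF nablaF)
    (nabla_LC : levi_civita (dwp_metric gB gF f h) nabla)
    (p : B) (q : F) (i : chart B) (j : chart F)
    (ip : cdom i p) (jq : cdom j q) :
  let n := (n1 + n2)%N in
  let x := chart_map i p in
  let y := chart_map j q in
  let c : chart (prod_manifold B F) := (i, j) in
  let z := chart_map c (p, q) in
  let g := dwp_metric gB gF f h c in
  let g1 := leaf1 g y in
  let g2 := leaf2 g x in
  let PM := lift_field P c in
  let fM := (f \o snd) \o chart_inv c in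
  let hM := (h \o fst) \o chart_inv c in
  let rt := scal g (semisym g (nabla c) PM) z in
  let rB := scal (gB i) (nablaB i) x in
  let rFt := scal (gF j) (semisym g2 (nablaF j) (P j)) y in
  let Lapf := laplacian g2 (nablaF j) (f \o chart_inv j) y in
  let Laph := laplacian g1 (nablaB i) (h \o chart_inv i) x in
  let divP := divergence g2 (nablaF j) (P j) y in
  let Pf := dirder PM fM z in
  let piP := inner (g z) (PM z) (PM z) in
  rt = rB / f q ^+ 2 + rFt / h p ^+ 2
     - n1%:R * (n1%:R - 1) * (metric_norm (g z) (grad g fM z) ^+ 2 / f q ^+ 2)
     - n2%:R * (n2%:R - 1) * (metric_norm (g z) (grad g hM z) ^+ 2 / h p ^+ 2)
     - 2 * n1%:R * (n%:R - 1) * (Pf / f q)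
     - 2 * n1%:R * (Lapf / f q)
     - 2 * n2%:R * (Laph / h p)
     - 2 * n1%:R * divP
     - n1%:R * (n%:R + n2%:R - 3) * piP.
Proof.
move=> n x y c z g g1 g2 PM fM hM rt rB rFt Lapf Laph divP Pf piP.
have Dx : cimg i x by exists p.
have Dy : cimg j y by exists q.
have zx : lsubmx z = x by rewrite /z /= row_mxKl.
have zy : rsubmx z = y by rewrite /z /= row_mxKr.
have Dz : prod_dom (cimg i) (cimg j) z by split; rewrite /= ?zx ?zy.
have hx : h (chart_inv i x) = h p by rewrite /x chart_mapK.
have fy : f (chart_inv j y) = f q by rewrite /y chart_mapK.
have h0 x' : (h \o chart_inv i) x' != 0 by rewrite gt_eqF// h_pos.
have f0 y' : (f \o chart_inv j) y' != 0 by rewrite gt_eqF// f_pos.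
have gB_pos x' : cimg i x' -> forall v, v != 0 -> 0 < inner (gB i x') v v.
  by move=> Dx' v v0; exact: (metric_pos gB_riem).
have gF_pos y' : cimg j y' -> forall v, v != 0 -> 0 < inner (gF j y') v v.
  by move=> Dy' v v0; exact: (metric_pos gF_riem).
(* The image of a product chart is the product of the images, which is the domain used in the local
   computation. *)
have LCc : levi_civita_on (prod_dom (cimg i) (cimg j))
    (dwp (gB i) (gF j) (h \o chart_inv i) (f \o chart_inv j)) (nabla c).
  have := nabla_LC c; rewrite /cimg.
  rewrite (_ : _ @` _ = prod_dom (cimg i) (cimg j))//.
  exact: (prod_coord_image (i, j)).
have g2E : g2 = fun y' => (h \o chart_inv i) x ^+ 2 *: gF j y'.
  apply/funext => y'; rewrite /g2 /leaf2 /g /dwp_metric /= row_mxKl row_mxKr.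
  by rewrite !scale_block_mx add_block_mx block_mxKdr scaler0 add0r.
have g1E : g1 = fun x' => (f \o chart_inv j) y ^+ 2 *: gB i x'.
  apply/funext => x'; rewrite /g1 /leaf1 /g /dwp_metric /= row_mxKl row_mxKr.
  by rewrite !scale_block_mx add_block_mx block_mxKul scaler0 addr0.
(* [Num.sqrt] vanishes on negative numbers, so recovering the square needs [inner (g z) v v] to be
   nonnegative; this holds blockwise. *)
have norm_sqr v : metric_norm (g z) v ^+ 2 = inner (g z) v v.
  rewrite /metric_norm sqr_sqrtr// (inner_dwp (gB i) (gF j) (h \o chart_inv i)
    (f \o chart_inv j) z).
  rewrite zx zy addr_ge0// mulr_ge0 ?sqr_ge0//; apply: inner_ge0.
  - exact: gB_pos.
  - exact: gF_pos.
have PfE : Pf = 'D_(P j y) (f \o chart_inv j) y.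
  rewrite /Pf /dirder (derive_rsubmx (f \o chart_inv j)) /PM /lift_field.
  by rewrite zy row_mxKr.
have PMz : PM z = row_mx 0 (P j y) by rewrite /PM /lift_field zy.
have main := scal_semisym_dwp
  (@chart_map_open _ _ B i) (@chart_map_open _ _ F j)
  (metric_smooth gB_riem i) (metric_smooth gF_riem j)
  (fun x' => @Defs.metric_sym _ _ _ _ gB_riem i x')
  (fun y' => @Defs.metric_sym _ _ _ _ gF_riem j y')
  (fun x' Dx' => pos_unitmx (gB_pos x' Dx'))
  (fun y' Dy' => pos_unitmx (gF_pos y' Dy'))
  (h_smooth i) (f_smooth j) (fun x' _ => h0 x') (fun y' _ => f0 y')
  (nablaB_LC i) (nablaF_LC j) LCc (P_field.1 j) Dz.
move: main => /=; rewrite zx zy hx fy => main.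
rewrite /rt /rB /rFt /Lapf /Laph /divP /piP !norm_sqr PfE PMz g2E g1E /= hx fy.
exact: main.
Qed.
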